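(* Let $G=(V,E)$ be a graph with nonnegative edge weights, $n=|V|$, $m=|E|$, and let $\mathcal{M}=(V,\mathcal{I})$ be an arbitrary matroid of rank $k$ accessible through an independence oracle. Then: (i) for any $\varepsilon>0$, there is an algorithm computing $S\in\mathcal{I}$ with $E_G(S)\ge \left(\frac{2}{3}-O(k\varepsilon)\right)\max_{X\in\mathcal{I}}E_G(X)$ using $O\left(\frac{mk}{\varepsilon}\right)$ arithmetic operations and $O\left(\frac{nk}{\varepsilon}\right)$ matroid oracle calls; (ii) there is an algorithm computing $S\in\mathcal{I}$ with $E_G(S)\ge \frac{2}{3}\max_{X\in\mathcal{I}}E_G(X)$ using $O(nmk^3)$ arithmetic operations and $O(n^2k^3)$ matroid oracle calls.
   Context: For $S\subseteq V$, $E_G(S)$ denotes the total weight of the edges of $G$ having at least one endpoint in $S$. An independence oracle answers, for a given $S\subseteq V$, whether $S\in\mathcal{I}$. *)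

(* Defs.v *)
From mathcomp Require Import all_boot all_order all_algebra.
From mathcomp Require Import reals.

Set Implicit Arguments.
Unset Strict Implicit.
Unset Printing Implicit Defensive.

Import Order.TTheory GRing.Theory Num.Theory.
Local Open Scope ring_scope.

Record wgraph (R : realType) (V : finType) := WGraph {
  edges : {set {set V}};
  weight : {set V} -> R;
  edges_card2 : forall e, e \in edges -> #|e| = 2;
  weight_ge0 : forall e, e \in edges -> 0 <= weight e }.

Definition coverage (R : realType) (V : finType) (G : wgraph R V)
    (S : {set V}) : R :=
  \sum_(e in edges G | ~~ [disjoint e & S]) weight G e.

Record matroid (V : finType) := Matroid {
  indep : {set {set V}};
  indep0 : set0 \in indep;
  indep_sub : forall A B : {set V}, A \subset B -> B \in indep -> A \in indep;
  indep_aug : forall A B : {set V}, A \in indep -> B \in indep ->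
    (#|A| < #|B|)%N -> exists2 x, x \in B :\: A & x |: A \in indep }.

Definition mrank (V : finType) (M : matroid V) : nat :=
  \max_(X in indep M) #|X|.

(* The default value 0 of the maximum is harmless: coverages are nonnegative
   and [set0] is always independent. *)
Definition max_coverage (R : realType) (V : finType) (G : wgraph R V)
    (M : matroid V) : R :=
  \big[Num.max/0]_(X in indep M) coverage G X.

(* Algorithms are closed, finite, first-order programs in a small strict
   functional language with real numbers, intrinsically typed and with de Bruijn
   variables. The vertex set, the weights and the matroid are not known to the
   program, so that one program handles all inputs: vertices can only be compared
   for equality, real numbers only be handled by field operations and
   comparisons, and the matroid only be accessed by querying the oracle. The only
   loop is the iteration over a finite list, so that every program terminates. *)
Inductive ty := TBool | TVertex | TReal | TList of ty | TPair of ty & ty.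

Inductive var : seq ty -> ty -> Type :=
| VZ ctx t : var (t :: ctx) t
| VS ctx t u : var ctx t -> var (u :: ctx) t.

Inductive arith := Add | Sub | Mul | Div.

Inductive term : seq ty -> ty -> Type :=
| Var ctx t : var ctx t -> term ctx t
| Let ctx t u : term ctx t -> term (t :: ctx) u -> term ctx u
| Bool ctx : bool -> term ctx TBool
| If ctx t : term ctx TBool -> term ctx t -> term ctx t -> term ctx t
| Pair ctx t u : term ctx t -> term ctx u -> term ctx (TPair t u)
| Fst ctx t u : term ctx (TPair t u) -> term ctx t
| Snd ctx t u : term ctx (TPair t u) -> term ctx u
| ListNil ctx t : term ctx (TList t)
| ListCons ctx t : term ctx t -> term ctx (TList t) -> term ctx (TList t)
(* [For l a b]: starting with the accumulator [a], run the body [b] for each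
   element of [l] in turn; in [b], variable 0 is the current element and
   variable 1 is the current accumulator *)
| For ctx t u : term ctx (TList t) -> term ctx u -> term [:: t, u & ctx] u ->
    term ctx u
| EqVertex ctx : term ctx TVertex -> term ctx TVertex -> term ctx TBool
| Numeral ctx : nat -> term ctx TReal
| Arith ctx : arith -> term ctx TReal -> term ctx TReal -> term ctx TReal
| Le ctx : term ctx TReal -> term ctx TReal -> term ctx TBool
| Indep ctx : term ctx (TList TVertex) -> term ctx TBool.

(* The input is the list of weighted edges (variable 0) and the list of vertices
   (variable 1); the output is a list of vertices. The rank is not part of the
   input. *)
Definition input_ctx : seq ty :=
  [:: TList (TPair (TPair TVertex TVertex) TReal); TList TVertex].

Definition program : Type := term input_ctx (TList TVertex).

Record outcome (A : Type) := Outcome { result : A; ops : nat; calls : nat }.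

Definition ret (A : Type) (x : A) : outcome A := Outcome x 0 0.

Definition bind (A B : Type) (o : outcome A) (f : A -> outcome B) : outcome B :=
  let o' := f (result o) in
  Outcome (result o') (ops o + ops o') (calls o + calls o').

Fixpoint den (R : realType) (V : finType) (t : ty) : Type :=
  match t with
  | TBool => bool
  | TVertex => V
  | TReal => R
  | TList u => seq (den R V u)
  | TPair u v => (den R V u * den R V v)%type
  end.

Fixpoint env (R : realType) (V : finType) (ctx : seq ty) : Type :=
  if ctx is t :: ctx' then (den R V t * env R V ctx')%type else unit.

Fixpoint lookup (R : realType) (V : finType) (ctx : seq ty) (t : ty)
    (x : var ctx t) : env R V ctx -> den R V t :=
  match x with
  | VZ _ _ => fun rho => rho.1
  | VS _ _ _ y => fun rho => lookup y rho.2
  end.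

Definition arith_op (R : realType) (o : arith) (x y : R) : R :=
  match o with
  | Add => x + y
  | Sub => x - y
  | Mul => x * y
  | Div => x / y
  end.

(* Every field operation, every comparison and every introduction of a numeral
   counts as one arithmetic operation, and every query as one oracle call; a
   query asks whether the set of the elements of the given list is independent. *)
Fixpoint eval (R : realType) (V : finType) (M : matroid V) (ctx : seq ty)
    (t : ty) (e : term ctx t) : env R V ctx -> outcome (den R V t) :=
  match e with
  | Var _ _ x => fun rho => ret (lookup x rho)
  | Let _ _ _ e1 e2 => fun rho =>
      bind (eval M e1 rho) (fun x => eval M e2 (x, rho))
  | Bool _ b => fun _ => ret b
  | If _ _ c e1 e2 => fun rho =>
      bind (eval M c rho)
        (fun b : bool => if b then eval M e1 rho else eval M e2 rho)
  | Pair _ _ _ e1 e2 => fun rho =>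
      bind (eval M e1 rho) (fun x =>
      bind (eval M e2 rho) (fun y => ret (x, y)))
  | Fst _ _ _ e1 => fun rho => bind (eval M e1 rho) (fun p => ret p.1)
  | Snd _ _ _ e1 => fun rho => bind (eval M e1 rho) (fun p => ret p.2)
  | ListNil _ _ => fun _ => ret [::]
  | ListCons _ _ e1 e2 => fun rho =>
      bind (eval M e1 rho) (fun x =>
      bind (eval M e2 rho) (fun l => ret (x :: l)))
  | For _ _ _ e1 e2 body => fun rho =>
      bind (eval M e1 rho) (fun l =>
      foldl (fun acc x => bind acc (fun a => eval M body (x, (a, rho))))
        (eval M e2 rho) l)
  | EqVertex _ e1 e2 => fun rho =>
      bind (eval M e1 rho) (fun x =>
      bind (eval M e2 rho) (fun y => ret (x == y)))
  | Numeral _ n => fun _ => Outcome n%:R 1 0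
  | Arith _ o e1 e2 => fun rho =>
      bind (eval M e1 rho) (fun x =>
      bind (eval M e2 rho) (fun y => Outcome (arith_op o x y) 1 0))
  | Le _ e1 e2 => fun rho =>
      bind (eval M e1 rho) (fun x =>
      bind (eval M e2 rho) (fun y => Outcome (x <= y) 1 0))
  | Indep _ e1 => fun rho =>
      bind (eval M e1 rho) (fun l => Outcome ([set x in l] \in indep M) 0 1)
  end.

(* [vs] lists every vertex once, and [es] lists every edge once, with its weight
   and with its endpoints in either order. *)
Definition input_of (R : realType) (V : finType) (G : wgraph R V)
    (vs : seq V) (es : seq (V * V * R)) : Prop :=
  perm_eq vs (enum V) /\
  perm_eq [seq ([set x.1.1; x.1.2], x.2) | x <- es]
          [seq (e, weight G e) | e <- enum (edges G)].

Definition run (R : realType) (V : finType) (M : matroid V) (P : program)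
    (vs : seq V) (es : seq (V * V * R)) : outcome {set V} :=
  bind (eval M P ((es, (vs, tt)) : env R V input_ctx))
    (fun l : seq V => ret [set x in l]).

(* Main.v *)
(* An edge of weight w contributes 0, 2w or 3w to the potential Phi(S) according
   to the number of its endpoints in S. Let S be a basis and O an independent
   set, extended to a basis. Summing the gains of the swaps given by the exchange
   property, if every swap increases Phi by at most delta, then
   2 E(O) - 3 E(S) <= k delta. The potential never exceeds 3 E, so along T best
   swaps, starting from a greedy basis, the gains telescope and the best set F
   that is seen satisfies 2 T E(O) <= 3 (T + k) E(F).

   (i) is the case T = O(1/eps). The gains of all vertices relative to S - a are
   computed together in O(m) operations, hence a round costs O(mk). For (ii), each
   vertex v is tried as an element of O: the edges at v are deleted, v is
   contracted, and T = 2k^2 rounds are run. If v covers at least E(O)/k, then the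
   factor 1 that is obtained on the edges at v, instead of 2/3, pays for the loss
   in T/(T + k). *)

Require Import Defs.
From mathcomp Require Import all_boot all_order all_algebra.
From mathcomp Require Import reals zify ring lra.

Set Implicit Arguments.
Unset Strict Implicit.
Unset Printing Implicit Defensive.

Import Order.TTheory GRing.Theory Num.Theory.
Local Open Scope ring_scope.

(** * Basis exchange *)

(** The cost bounds shape the programs. The bound on operations vanishes when there is no edge or
    the rank is 0, and even a numeral counts, so every additive constant must be absorbed by a
    factor known to be positive: arithmetic starts only once a nonempty independent set and an edge
    are at hand. Vertex comparisons and list handling are free; only arithmetic on weights and
    queries have to be rationed.

    Waiting for a local optimum could take a number of swaps that depends on the weights. With a
    fixed number of rounds, it is enough that the increase of the potential is small on average. As
    the rank is not given, the size of a greedy set of non-isolated vertices stands in for it;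
    isolated vertices cover nothing and are left out throughout.

    Deleting the edges at a guessed vertex makes coverage additive, and contracting the vertex keeps
    the sets found compatible with it; so the same search, run on a contracted matroid, serves both
    algorithms. *)

Section Exchange.
Variables (V : finType) (M : matroid V).
Implicit Types (A B S O : {set V}).

Lemma indep_extend A B : A \in indep M -> B \in indep M -> (#|A| <= #|B|)%N ->
  exists C : {set V},
    [/\ A \subset C, C \subset A :|: B, C \in indep M & #|C| = #|B|].
Proof.
move: {2}(#|B| - #|A|)%N (erefl (#|B| - #|A|)%N) => d.
elim: d A => [|d IHd] A dE iA iB leAB.
  by exists A; split=> //; [exact: subsetUl | lia].
have [|x /setDP[xB xA] iAx] := indep_aug iA iB; first lia.
have cAx : #|x |: A| = #|A|.+1 by rewrite cardsU1 xA.
have dE' : (#|B| - #|x |: A|)%N = d by lia.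
have [|C [sC CsU iC cC]] := IHd _ dE' iAx iB; first lia.
exists C; split=> //; first exact: subset_trans (subsetUr _ _) sC.
apply: subset_trans CsU _.
by rewrite -setUA subUset subxx andbT sub1set inE xB orbT.
Qed.

(** [D] collects the elements of [O] that [a] can replace; if [a |: O] is dependent, [a |: D] is the
    fundamental circuit. If no element of [D] could replace [a] in [S], then [S :\ a] would span
    [D], and [a |: D] would be independent. Extending it to the size of [O] inside [a |: O] would
    drop some [b] of [O], which lies in [D] by definition, although all of [D] was kept. *)
Lemma symmetric_exchange S O a : S \in indep M -> O \in indep M ->
  #|S| = #|O| -> a \in S -> a \notin O ->
  exists2 b, b \in O :\: S &
    (b |: (S :\ a) \in indep M) && (a |: (O :\ b) \in indep M).
Proof.
move=> iS iO cSO aS aO.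
pose D := [set b in O | a |: (O :\ b) \in indep M].
have sDO : D \subset O by apply/subsetP=> b; rewrite inE => /andP[].
have iD : D \in indep M by exact: indep_sub iO.
have iSa : S :\ a \in indep M by apply: indep_sub iS; exact: subsetDl.
have cSa : #|S| = #|S :\ a|.+1 by rewrite (cardsD1 a) aS.
have [|noB] := boolP
  [exists b in D, (b \notin S) && (b |: (S :\ a) \in indep M)].
  case/exists_inP=> b; rewrite inE => /andP[bO ib] /andP[bS ibS].
  by exists b; [rewrite inE bS | rewrite ibS].
(* [S :\ a] spans [D]: an element augmenting it would lie in [D] and outside [S], hence be the
   excluded replacement of [a]. *)
have grow J : J \in indep M -> J \subset D :|: (S :\ a) ->
    (#|J| <= #|S :\ a|)%N.
  move=> iJ sJ; rewrite leqNgt; apply/negP.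
  move=> /(indep_aug iSa iJ)[x /setDP[xJ xSa] ix].
  case/negP: noB; apply/exists_inP; exists x.
    by have := subsetP sJ _ xJ; rewrite inE (negPf xSa) orbF.
  rewrite ix andbT; apply: contra xSa => xS; rewrite !inE xS andbT.
  apply: contraNneq aO => xa; have := subsetP sJ _ xJ.
  by rewrite xa inE setD11 orbF => /(subsetP sDO).
have [|J [sDJ sJ iJ cJ]] := indep_extend iD iSa.
  by apply: grow => //; exact: subsetUl.
have [|x /setDP[xS xJ] ixJ] := indep_aug iJ iS; first by rewrite cJ cSa.
have xa : x = a.
  apply/eqP/negPn/negP=> xa.
  suff: (#|x |: J| <= #|S :\ a|)%N by rewrite cardsU1 xJ cJ add1n ltnn.
  by apply: grow => //; rewrite subUset sJ sub1set !inE xa xS orbT.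
have iDa : a |: D \in indep M.
  by apply: indep_sub ixJ; rewrite xa setUS.
have cDO : (#|a |: D| <= #|O|)%N.
  rewrite cardsU1 (contra (subsetP sDO a) aO) add1n -cSO cSa ltnS -cJ.
  exact: subset_leq_card.
have [C [sDC sC iC cC]] := indep_extend iDa iO cDO.
have aC : a \in C by apply: (subsetP sDC); rewrite !inE eqxx.
have CO : C :\ a \subset O.
  apply/subsetP=> y; rewrite in_setD1 => /andP[ya yC].
  have := subsetP sC _ yC.
  by rewrite in_setU in_setU1 (negPf ya) => /orP[/(subsetP sDO)|].
have [b bO bC] : exists2 b, b \in O & b \notin C :\ a.
  apply/subsetPn; apply/negP=> /subset_leq_card.
  by rewrite -cC (cardsD1 a) aC ltnn.
(* By counting, [C] trades exactly one element [b] of [O] for [a]. This puts [b] into [D], which [C]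
   contains. *)
have CE : C = a |: (O :\ b).
  apply/eqP; rewrite eqEcard; apply/andP; split.
    apply/subsetP=> y yC; rewrite !inE; have [//|ya /=] := eqVneq y a.
    have yCa : y \in C :\ a by rewrite !inE ya.
    by rewrite (subsetP CO) // andbT; apply: contraNneq bC => <-.
  rewrite cC cardsU1 !inE (negPf aO) andbF [X in (_ <= X)%N](cardsD1 b) bO //.
have bD : b \in D by rewrite inE bO -CE.
case/negP: bC; rewrite in_setD1 (subsetP sDC) ?in_setU1 ?bD ?orbT // andbT.
by apply: contraNneq aO => <-.
Qed.

(* Replacing [b] by [a] in [O] decreases [#|O :\: S|]; this induction avoids the
   construction of a bijection between [O :\: S] and [S :\: O]. *)
Lemma exchange_sum (R : realType) (p : V -> R) (delta : R) S O :
  S \in indep M -> O \in indep M -> #|S| = #|O| ->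
  (forall a b, a \in S -> b \notin S -> b |: (S :\ a) \in indep M ->
    p b <= p a + delta) ->
  \sum_(b in O :\: S) p b <= \sum_(a in S :\: O) p a + #|O :\: S|%:R * delta.
Proof.
move: {2}#|O :\: S| (erefl #|O :\: S|) => d.
elim: d O => [|d IHd] O dE iS iO cSO pP.
  have sOS : O \subset S by rewrite -setD_eq0 -cards_eq0 dE.
  have -> : O = S by apply/eqP; rewrite eqEcard sOS cSO leqnn.
  by rewrite setDv big_set0 cards0 mul0r addr0.
have [a /setDP[aS aO]] : exists a, a \in S :\: O.
  apply/set0Pn; rewrite -card_gt0 cardsD setIC.
  by have := cardsD O S; rewrite dE; have := subset_leq_card (subsetIl O S); lia.
have [b bOS /andP[ibS iaO]] := symmetric_exchange iS iO cSO aS aO.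
have [bO bS] := setDP bOS.
have ab : a != b by apply: contraNneq bS => <-.
pose O' := a |: (O :\ b).
have EOS : O' :\: S = (O :\: S) :\ b.
  apply/setP=> x; rewrite !inE; have [->|_] := eqVneq x a; first by rewrite aS !andbF.
  by rewrite /= andbCA.
have ESO : S :\: O' = (S :\: O) :\ a.
  apply/setP=> x; rewrite !inE; have [->|_] := eqVneq x a => //=.
  by have [->|_] := eqVneq x b => //=; rewrite (negPf bS) !andbF.
have cO' : #|S| = #|O'|.
  by rewrite cSO (cardsD1 b O) bO /O' cardsU1 !inE (negPf aO) andbF.
have dE' : #|O' :\: S| = d.
  by rewrite EOS; move: dE; rewrite (cardsD1 b (O :\: S)) bOS; lia.
have := IHd O' dE' iS iaO cO' pP.
rewrite EOS ESO => IH.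
have aSO : a \in S :\: O by rewrite inE aO.
rewrite (big_setD1 b bOS) (big_setD1 a aSO) dE -EOS /=.
have := pP a b aS bS ibS; move: IH; rewrite -EOS dE' -natr1.
set X := \sum_(_ in _) _; set Y := \sum_(_ in _) _ => IH.
by lra.
Qed.

End Exchange.

(** * The potential *)

Section Potential.
Variables (R : realType) (V : finType).
Implicit Types (es : seq (V * V * R)) (X Y S O : {set V}).

Definition cov es X : R :=
  \sum_(x <- es) x.2 * ((x.1.1 \in X) || (x.1.2 \in X))%:R.

Definition phi es X : R :=
  \sum_(x <- es) x.2 *
    (((x.1.1 \in X) || (x.1.2 \in X)).*2 + ((x.1.1 \in X) && (x.1.2 \in X)))%:R.

(** An edge at [b] rises from 0 to 2 if its other endpoint is outside [X], and from 2 to 3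
    otherwise. The formula also makes sense for [b] in [X], where it is the loss caused by removing
    [b]. *)
Definition gain es X (b : V) : R :=
  \sum_(x <- es) x.2 *
    ((b == x.1.1) * (1 + (x.1.2 \notin X))
     + (b == x.1.2) * (1 + (x.1.1 \notin X)))%:R.

Definition wf_edges es :=
  forall x, x \in es -> x.1.1 != x.1.2 /\ 0 <= x.2.

Lemma phi_setU1 es X b : wf_edges es -> b \notin X ->
  phi es (b |: X) = phi es X + gain es X b.
Proof.
move=> wf bX; rewrite /phi /gain -big_split /=; apply: eq_big_seq => -[[u v] w].
move=> /wf[/= uv _]; rewrite -mulrDr -natrD; congr (_ * _%:R).
rewrite !inE ![b == _]eq_sym.
have [ub|ub] := eqVneq u b; first rewrite -{}ub in bX *.
  rewrite eq_sym in uv; rewrite (negPf uv) (negPf bX) /=.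
  by case: (v \in X).
have [vb|vb] := eqVneq v b; first rewrite -{}vb in bX *.
  by rewrite (negPf bX) /=; case: (u \in X).
by rewrite /=; lia.
Qed.

(** Diminishing returns of the potential: the first endpoint of an edge earns 2, the second only
    1. *)
Lemma gain_sub es X Y b : wf_edges es -> X \subset Y ->
  gain es Y b <= gain es X b.
Proof.
move=> wf /subsetP sXY; rewrite /gain !big_seq; apply: ler_sum => x /wf[_ w0].
apply: ler_wpM2l => //; rewrite ler_nat.
have sub z : ((z \notin Y) <= (z \notin X))%N.
  by have := sXY z; case: (z \in X) => //; case: (z \in Y) => // /(_ isT).
by apply: leq_add; rewrite leq_mul2l leq_add2l sub orbT.
Qed.

(** There are no loops, so the gain of [a] only looks at the membership of vertices other than
    [a]. *)
Lemma gain_setD1 es X a : wf_edges es -> gain es (X :\ a) a = gain es X a.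
Proof.
move=> wf; apply: eq_big_seq => -[[u v] w] /wf[/= uv _]; congr (_ * _%:R).
rewrite !inE ![_ == a]eq_sym; case: (eqVneq a u) uv => [<-|_] uv /=.
  by rewrite (negPf uv).
by case: (eqVneq a v).
Qed.

Lemma cov_ge0 es X : wf_edges es -> 0 <= cov es X.
Proof.
move=> wf; rewrite /cov big_seq; apply: sumr_ge0 => x /wf[_ w0].
exact: mulr_ge0.
Qed.

Lemma phi_ge0 es X : wf_edges es -> 0 <= phi es X.
Proof.
move=> wf; rewrite /phi big_seq; apply: sumr_ge0 => x /wf[_ w0].
exact: mulr_ge0.
Qed.

Lemma cov_sub es X Y : wf_edges es -> X \subset Y -> cov es X <= cov es Y.
Proof.
move=> wf /subsetP sXY; rewrite /cov !big_seq; apply: ler_sum => x /wf[_ w0].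
apply: ler_wpM2l => //; rewrite ler_nat.
have := sXY x.1.1; have := sXY x.1.2.
by case: (_ \in X) => [/(_ isT)->|_]; case: (_ \in X) => [/(_ isT)->|_]; rewrite ?orbT.
Qed.

Lemma phi_le_cov es X : wf_edges es -> phi es X <= 3 * cov es X.
Proof.
move=> wf; rewrite /phi /cov big_distrr /= !big_seq; apply: ler_sum => x /wf[_ w0].
rewrite mulrCA; apply: ler_wpM2l => //.
by rewrite -natrM ler_nat; do 2!case: (_ \in X).
Qed.

Lemma sum_pick (A : {set V}) (u : V) (c : nat) :
  (\sum_(b in A) (b == u) * c = (u \in A) * c)%N.
Proof.
case uA: (u \in A).
  by rewrite (bigD1 u) //= eqxx big1 ?addn0 // => b /andP[_ /negPf->].
by apply: big1 => b bA; case: eqVneq => // bu; rewrite -bu bA in uA.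
Qed.

Lemma sum_gain es X (A : {set V}) : \sum_(b in A) gain es X b =
  \sum_(x <- es) x.2 * ((x.1.1 \in A) * (1 + (x.1.2 \notin X))
                        + (x.1.2 \in A) * (1 + (x.1.1 \notin X)))%:R.
Proof.
rewrite /gain exchange_big /=; apply: eq_bigr => x _.
by rewrite -big_distrr -natr_sum big_split /= !sum_pick.
Qed.

(* The values 0, 2, 3 of the potential are the ones for which this holds edge by
   edge. *)
Lemma cov_exchange es S O : wf_edges es ->
  2 * cov es O + \sum_(a in S :\: O) gain es S a <=
  3 * cov es S + \sum_(b in O :\: S) gain es S b.
Proof.
move=> wf; rewrite !sum_gain /cov !big_distrr /= -!big_split /= !big_seq.
apply: ler_sum => -[[u v] w] /wf[/= _ w0].
rewrite ![_ * (w * _)]mulrCA -!mulrDr; apply: ler_wpM2l => //.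
rewrite -!natrM -!natrD ler_nat !inE.
by do 2!case: (u \in _); do 2!case: (v \in _).
Qed.

(** [exchange_sum] needs one price per vertex, independent of the swap partner. The gain over [S] is
    such a price: it is the exact loss for [a], and by [gain_sub] it underestimates the true gain of
    [b] over [S :\ a]. *)
Lemma local_search_step (M : matroid V) es S O (delta : R) :
  wf_edges es -> S \in indep M -> O \in indep M -> (#|O| <= #|S|)%N ->
  0 <= delta ->
  (forall a b, a \in S -> b \notin S -> b |: (S :\ a) \in indep M ->
    phi es (b |: (S :\ a)) <= phi es S + delta) ->
  2 * cov es O - 3 * cov es S <= #|S|%:R * delta.
Proof.
move=> wf iS iO cOS d0 dP.
have [C [sOC _ iC cC]] := indep_extend iO iS cOS.
have := @exchange_sum _ M R (gain es S) delta S C iS iC (esym cC).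
have h a b : a \in S -> b \notin S -> b |: (S :\ a) \in indep M ->
    gain es S b <= gain es S a + delta.
  move=> aS bS ib; have := dP a b aS bS ib.
  rewrite phi_setU1 // ?inE ?(negPf bS) ?andbF //.
  have : phi es S = phi es (S :\ a) + gain es S a.
    by rewrite -(gain_setD1 S a wf) -phi_setU1 ?setD11 // setD1K.
  by have := gain_sub b wf (subsetDl S [set a]); lra.
move=> /(_ h) {h}; have := cov_exchange S C wf.
have : #|C :\: S|%:R * delta <= #|S|%:R * delta.
  by apply: ler_wpM2r => //; rewrite ler_nat -cC subset_leq_card // subsetDl.
by have := cov_sub wf sOC; lra.
Qed.

End Potential.

(** * Contraction of a matroid, restricted to a set of vertices *)

Section Contraction.
Variables (V : finType) (M : matroid V) (U B : {set V}).
Hypotheses (UB : [disjoint U & B]) (iB : B \in indep M).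

(** Disjointness of [U] and [B] makes cardinalities add up, so augmentation is inherited from [M];
    an augmenting element outside [X :|: B] necessarily comes from [Y]. *)
Definition contract_indep : {set {set V}} :=
  [set X : {set V} | (X \subset U) && (X :|: B \in indep M)].

Lemma contract_indep0 : set0 \in contract_indep.
Proof. by rewrite inE sub0set set0U. Qed.

Lemma contract_indep_sub (X Y : {set V}) :
  X \subset Y -> Y \in contract_indep -> X \in contract_indep.
Proof.
move=> sXY; rewrite !inE => /andP[YU iY]; rewrite (subset_trans sXY YU) /=.
by apply: indep_sub iY; exact: setSU.
Qed.

Lemma contract_indep_aug (X Y : {set V}) :
  X \in contract_indep -> Y \in contract_indep -> (#|X| < #|Y|)%N ->
  exists2 x, x \in Y :\: X & x |: X \in contract_indep.
Proof.
rewrite !inE => /andP[XU iX] /andP[YU iY] cXY.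
have cU (Z : {set V}) : Z \subset U -> #|Z :|: B| = (#|Z| + #|B|)%N.
  move=> ZU; apply/eqP; rewrite (leq_card_setU Z B); exact: disjointWl ZU UB.
have [|x] := indep_aug iX iY; first by rewrite !cU // ltn_add2r.
rewrite !inE negb_or => /andP[/andP[xX xB]]; rewrite (negPf xB) orbF => xY ix.
exists x; first by rewrite inE xX.
by rewrite inE -setUA ix andbT subUset XU sub1set (subsetP YU).
Qed.

Definition contraction : matroid V :=
  Matroid contract_indep0 contract_indep_sub contract_indep_aug.

End Contraction.

(** * Results and costs of programs *)

(** A Hoare-style postcondition with upper bounds on both costs. Bounds, unlike exact costs, can be
    shared by the branches of a conditional. *)
Definition runs (A : Type) (o : outcome A) (Q : A -> Prop) (c d : nat) : Prop :=
  [/\ Q (result o), (ops o <= c)%N & (calls o <= d)%N].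

Section Logic.
Variables (R : realType) (V : finType) (M : matroid V).
Implicit Types (ctx : seq ty) (t u : ty).

Notation ev e rho := (@eval R V M _ _ e rho).

Lemma runs_weak A (o : outcome A) (Q Q' : A -> Prop) c c' d d' :
  runs o Q c d -> (c <= c')%N -> (d <= d')%N -> (forall x, Q x -> Q' x) ->
  runs o Q' c' d'.
Proof.
by move=> [q hc hd] lc ld QQ'; split;
  [exact: QQ' | exact: leq_trans lc | exact: leq_trans ld].
Qed.

Lemma runs_ret A (o : outcome A) (x : A) (Q : A -> Prop) c d :
  o = ret x -> Q x -> runs o Q c d.
Proof. by move=> -> q; split. Qed.

Lemma runs_bind A B (o : outcome A) (f : A -> outcome B) P Q c1 d1 c2 d2 :
  runs o P c1 d1 -> (forall x, P x -> runs (f x) Q c2 d2) ->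
  runs (bind o f) Q (c1 + c2) (d1 + d2).
Proof.
move=> [p hc hd] fP; have [q hc' hd'] := fP _ p.
by split=> //=; exact: leq_add.
Qed.

Lemma runs_var ctx t (x : var ctx t) (rho : env R V ctx) (Q : den R V t -> Prop) :
  Q (lookup x rho) -> runs (ev (Var x) rho) Q 0 0.
Proof. by []. Qed.

Lemma runs_nil ctx t (rho : env R V ctx) (Q : den R V (TList t) -> Prop) :
  Q [::] -> runs (ev (ListNil ctx t) rho) Q 0 0.
Proof. by []. Qed.

Lemma runs_let ctx t u (e1 : term ctx t) (e2 : term (t :: ctx) u)
    (rho : env R V ctx) P Q c1 d1 c2 d2 :
  runs (ev e1 rho) P c1 d1 ->
  (forall x : den R V t, P x -> runs (ev e2 (x, rho)) Q c2 d2) ->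
  runs (ev (Let e1 e2) rho) Q (c1 + c2) (d1 + d2).
Proof. exact: runs_bind. Qed.

(* An expression that costs nothing and has an explicit value is handled by
   rewriting instead of by a postcondition. *)
Lemma runs_let_ret ctx t u (e1 : term ctx t) (e2 : term (t :: ctx) u)
    (rho : env R V ctx) x Q c d :
  ev e1 rho = ret x -> runs (ev e2 (x, rho)) Q c d ->
  runs (ev (Let e1 e2) rho) Q c d.
Proof. by rewrite /= => -> [q hc hd]; split. Qed.

Lemma runs_if_ret ctx t (b : term ctx TBool) (e1 e2 : term ctx t)
    (rho : env R V ctx) (x : bool) Q c d :
  ev b rho = ret x ->
  (x -> runs (ev e1 rho) Q c d) -> (~~ x -> runs (ev e2 rho) Q c d) ->
  runs (ev (If b e1 e2) rho) Q c d.
Proof.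
by rewrite /= => ->; case: x => /= [/(_ isT)[q hc hd] _|_ /(_ isT)[q hc hd]]; split.
Qed.

Lemma runs_if_indep ctx t (l : term ctx (TList TVertex)) (e1 e2 : term ctx t)
    (rho : env R V ctx) (x : seq V) Q c d :
  ev l rho = ret x ->
  ([set y in x] \in indep M -> runs (ev e1 rho) Q c d) ->
  ([set y in x] \notin indep M -> runs (ev e2 rho) Q c d) ->
  runs (ev (If (Indep l) e1 e2) rho) Q c d.+1.
Proof.
rewrite /runs /= => -> /=; case: ([set y in x] \in indep M).
  by case/(_ isT) => q hc hd _; split=> //=; lia.
by move=> _ /(_ isT)[q hc hd]; split=> //=; lia.
Qed.

Lemma runs_if_le ctx t (a b : term ctx TReal) (e1 e2 : term ctx t)
    (rho : env R V ctx) (x y : R) Q ca da cb db c d :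
  runs (ev a rho) (eq^~ x) ca da -> runs (ev b rho) (eq^~ y) cb db ->
  (x <= y -> runs (ev e1 rho) Q c d) -> (y < x -> runs (ev e2 rho) Q c d) ->
  runs (ev (If (Le a b) e1 e2) rho) Q (ca + cb + c).+1 (da + db + d).
Proof.
move=> [ra ha ha'] [rb hb hb'] h1 h2; rewrite /runs /= ra rb.
rewrite /= in ha ha' hb hb'.
by case: leP => [/h1|/h2] [q hc hd]; split=> //=; lia.
Qed.

Lemma runs_pair ctx t u (e1 : term ctx t) (e2 : term ctx u) (rho : env R V ctx)
    (x : den R V t) (y : den R V u) (Q : den R V (TPair t u) -> Prop) :
  ev e1 rho = ret x -> ev e2 rho = ret y -> Q (x, y) ->
  runs (ev (Pair e1 e2) rho) Q 0 0.
Proof. by move=> /= -> ->. Qed.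

Lemma runs_snd ctx t u (e : term ctx (TPair t u)) (rho : env R V ctx)
    (P : den R V (TPair t u) -> Prop) (Q : den R V u -> Prop) c d :
  runs (ev e rho) P c d -> (forall p, P p -> Q p.2) ->
  runs (ev (Snd e) rho) Q c d.
Proof. by move=> [p hc hd] PQ; split; rewrite /= ?addn0 //; exact: PQ. Qed.

Lemma runs_arith ctx o (a b : term ctx TReal) (rho : env R V ctx) x y ca da cb db :
  runs (ev a rho) (eq^~ x) ca da -> runs (ev b rho) (eq^~ y) cb db ->
  runs (ev (Arith o a b) rho) (eq^~ (arith_op o x y)) (ca + cb).+1 (da + db).
Proof.
move=> [ra ha ha'] [rb hb hb']; rewrite /= in ha ha' hb hb'.
by rewrite /runs /= ra rb; split=> //; lia.
Qed.

(** The invariant speaks of the prefix already processed. The cost may vary with the element: the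
    gains of all vertices are cheap only in total, as the degrees sum up. *)
Lemma runs_foldl T A (f : outcome A -> T -> outcome A) (F : A -> T -> outcome A)
    (I : seq T -> A -> Prop) (cf df : T -> nat) (l : seq T) o c d :
  (forall o x, f o x = bind o (F^~ x)) ->
  runs o (I [::]) c d ->
  (forall l1 x l2 a, l = l1 ++ x :: l2 -> I l1 a ->
    runs (F a x) (I (rcons l1 x)) (cf x) (df x)) ->
  runs (foldl f o l) (I l) (c + \sum_(x <- l) cf x) (d + \sum_(x <- l) df x).
Proof.
move=> fE o0; elim/last_ind: l => [|l x IHl] FP; first by rewrite !big_nil !addn0.
rewrite foldl_rcons fE -cats1 !big_cat !big_seq1 /= !addnA cats1.
apply: (runs_bind (P := I l)); last first.
  by move=> a Ia; apply: (FP l x [::]) => //; rewrite cats1.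
by apply: IHl => l1 y l2 a lE; apply: (FP l1 y (rcons l2 x)); rewrite lE rcons_cat.
Qed.

Lemma runs_for ctx t u (e1 : term ctx (TList t)) (e2 : term ctx u)
    (b : term [:: t, u & ctx] u) (rho : env R V ctx) (l : seq (den R V t))
    (I : seq (den R V t) -> den R V u -> Prop) (cf df : den R V t -> nat) c d :
  ev e1 rho = ret l ->
  runs (ev e2 rho) (I [::]) c d ->
  (forall l1 x l2 (a : den R V u), l = l1 ++ x :: l2 -> I l1 a ->
    runs (ev b (x, (a, rho))) (I (rcons l1 x)) (cf x) (df x)) ->
  runs (ev (For e1 e2 b) rho) (I l) (c + \sum_(x <- l) cf x) (d + \sum_(x <- l) df x).
Proof.
rewrite /= => -> h0 hb; have := runs_foldl (f := fun acc x =>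
  bind acc (fun a => ev b (x, (a, rho)))) (fun _ _ => erefl) h0 hb.
by case=> q hc hd; split.
Qed.

Lemma foldl_ret T A (f : outcome A -> T -> outcome A) (F : A -> T -> A) l a0 :
  (forall a x, f (ret a) x = ret (F a x)) ->
  foldl f (ret a0) l = ret (foldl F a0 l).
Proof. by move=> fE; elim: l a0 => //= x l IHl a0; rewrite fE IHl. Qed.

(** A loop whose body is free is itself free and equals a pure fold. Membership tests, filters and
    concatenation are handled this way. *)
Lemma eval_for_ret ctx t u (e1 : term ctx (TList t)) (e2 : term ctx u)
    (b : term [:: t, u & ctx] u) (rho : env R V ctx) (l : seq (den R V t))
    (a0 : den R V u) (F : den R V u -> den R V t -> den R V u) :
  ev e1 rho = ret l -> ev e2 rho = ret a0 ->
  (forall x a, ev b (x, (a, rho)) = ret (F a x)) ->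
  ev (For e1 e2 b) rho = ret (foldl F a0 l).
Proof.
rewrite /= => -> -> bE;
transitivity (bind (ret l) (fun l' => ret (foldl F a0 l'))) => //.
rewrite {1}/bind /= (foldl_ret (F := F)) // => a x.
by rewrite {1}/bind /= bE.
Qed.

End Logic.

(** * Building blocks of the programs *)

Notation V0 := (VZ _ _).
Notation V1 := (VS _ V0).
Notation V2 := (VS _ V1).
Notation V3 := (VS _ V2).
Notation V4 := (VS _ V3).
Notation V5 := (VS _ V4).
Notation V6 := (VS _ V5).
Notation V7 := (VS _ V6).
Notation LV := (TList TVertex).
Notation edge := (TPair (TPair TVertex TVertex) TReal).
Notation LE := (TList edge).

Fixpoint weaken ctx t (pre : seq ty) (x : var ctx t) : var (pre ++ ctx) t :=
  if pre is u :: pre' then VS u (weaken pre' x) else x.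

Section Loops.
Variable ctx : seq ty.

Definition mem_prog (x : var ctx TVertex) (l : var ctx LV) : term ctx TBool :=
  For (Var l) (Bool _ false)
    (If (EqVertex (Var (VS _ (VS _ x))) (Var V0)) (Bool _ true) (Var V1)).

Definition app_prog (l1 l2 : var ctx LV) : term ctx LV :=
  For (Var l1) (Var l2) (ListCons (Var V0) (Var V1)).

Definition filter_prog t (l : var ctx (TList t))
    (c : term [:: t, TList t & ctx] TBool) : term ctx (TList t) :=
  For (Var l) (ListNil _ _) (If c (ListCons (Var V0) (Var V1)) (Var V1)).

Definition incident_prog (x : var ctx TVertex) (e : var ctx edge) : term ctx TBool :=
  If (EqVertex (Var x) (Fst (Fst (Var e)))) (Bool _ true)
     (EqVertex (Var x) (Snd (Fst (Var e)))).

(** In the body [b], variable 0 is the weight, variables 1 and 2 are the second and first endpoints,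
    variable 3 is the edge and variable 4 the partial sum. *)
Definition sum_prog (es : var ctx LE)
    (b : term [:: TReal, TVertex, TVertex, edge, TReal & ctx] TReal) :
    term ctx TReal :=
  For (Var es) (Numeral _ 0)
    (Let (Fst (Fst (Var V0))) (Let (Snd (Fst (Var V1))) (Let (Snd (Var V2)) b))).

End Loops.

Section Sums.
Variable ctx : seq ty.

Definition cov_prog (es : var ctx LE) (S : var ctx LV) : term ctx TReal :=
  let S' := weaken [:: TReal; TVertex; TVertex; edge; TReal] S in
  sum_prog es
    (If (mem_prog V2 S') (Arith Add (Var V4) (Var V0))
       (If (mem_prog V1 S') (Arith Add (Var V4) (Var V0)) (Var V4))).

Definition phi_prog (es : var ctx LE) (S : var ctx LV) : term ctx TReal :=
  let S' := weaken [:: TReal; TVertex; TVertex; edge; TReal] S in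
  let acc2 := Arith Add (Var V4) (Arith Add (Var V0) (Var V0)) in
  sum_prog es
    (If (mem_prog V2 S') (If (mem_prog V1 S') (Arith Add acc2 (Var V0)) acc2)
       (If (mem_prog V1 S') acc2 (Var V4))).

(** Only edges at [b] cause arithmetic, at most two additions each. The cost is thus proportional to
    the degree of [b], and all vertices together cost O(m) beyond a constant per vertex. *)
Definition gain_prog (es : var ctx LE) (S : var ctx LV) (b : var ctx TVertex) :
    term ctx TReal :=
  let S' := weaken [:: TReal; TVertex; TVertex; edge; TReal] S in
  let b' := weaken [:: TReal; TVertex; TVertex; edge; TReal] b in
  let acc1 := Arith Add (Var V4) (Var V0) in
  let acc2 := Arith Add acc1 (Var V0) in
  sum_prog es
    (If (EqVertex (Var b') (Var V2)) (If (mem_prog V1 S') acc1 acc2)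
       (If (EqVertex (Var b') (Var V1)) (If (mem_prog V2 S') acc1 acc2) (Var V4))).

(* Only the vertices found here are looped over: there are at most 2m of them, and
   no operation may be spent if there is no edge. *)
Definition active_prog (vs : var ctx LV) (es : var ctx LE) : term ctx LV :=
  filter_prog vs
    (For (Var (weaken [:: TVertex; LV] es)) (Bool _ false)
       (If (incident_prog V2 V0) (Bool _ true) (Var V1))).

Definition greedy_prog (U B : var ctx LV) : term ctx LV :=
  For (Var U) (ListNil _ _)
    (If (Indep (ListCons (Var V0) (app_prog V1 (weaken [:: TVertex; LV] B))))
       (ListCons (Var V0) (Var V1)) (Var V1)).

(** Iteration is the only way to inspect a list; a loop that ignores the elements tests emptiness at
    no cost. *)
Definition nonempty_prog t (l : var ctx (TList t)) : term ctx TBool :=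
  For (Var l) (Bool _ false) (Bool _ true).

End Sums.

(* The accumulator holds the best set so far together with its potential; [B] is
   the list of contracted vertices. *)
Definition step_prog ctx (es : var ctx LE) (U B S : var ctx LV) :
    term ctx (TPair TReal LV) :=
  For (Var S) (Let (phi_prog es S) (Pair (Var V0) (Var (VS _ S))))
    (Let (filter_prog (weaken [:: TVertex; TPair TReal LV] S)
            (If (EqVertex (Var V0) (Var V2)) (Bool _ false) (Bool _ true)))
    (Let (phi_prog (weaken [:: LV; TVertex; TPair TReal LV] es) V0)
    (For (Var (weaken [:: TReal; LV; TVertex; TPair TReal LV] U)) (Var V3)
       (If (mem_prog V0 V3) (Var V1)
       (If (Indep (ListCons (Var V0) (app_prog V3
              (weaken [:: TVertex; TPair TReal LV; TReal; LV; TVertex;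
                          TPair TReal LV] B))))
          (Let (Arith Add (Var V2) (gain_prog
                  (weaken [:: TVertex; TPair TReal LV; TReal; LV; TVertex;
                              TPair TReal LV] es) V3 V0))
             (If (Le (Fst (Var V2)) (Var V0))
                (Pair (Var V0) (ListCons (Var V1) (Var V4)))
                (Var V2)))
          (Var V1)))))).

(** * Values and costs of the building blocks *)

Section Primitives.
Variables (R : realType) (V : finType) (M : matroid V).
Notation ev e rho := (@eval R V M _ _ e rho).
Notation lk x rho := (@lookup R V _ _ x rho).

Lemma eval_mem ctx (x : var ctx TVertex) (l : var ctx LV) (rho : env R V ctx) :
  ev (mem_prog x l) rho = ret ((lk x rho : V) \in (lk l rho : seq V)).
Proof.
rewrite /mem_prog (@eval_for_ret R V M _ TVertex TBool _ _ _ rho (lk l rho) false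
  (fun b y => if (lk x rho : V) == y then true else b)) //.
  congr ret; rewrite -[RHS]orbF; move: false => b.
  elim: (lk l rho : seq V) b => //= y s IHs b; rewrite IHs in_cons.
  by case: (_ == y); rewrite ?orbT.
by move=> y b; rewrite /= /bind /=; case: (_ == y).
Qed.

Lemma eval_nonempty ctx t (l : var ctx (TList t)) (rho : env R V ctx) :
  ev (nonempty_prog l) rho = ret (~~ nilp (lk l rho : seq (den R V t))).
Proof.
rewrite /nonempty_prog (@eval_for_ret R V M _ t TBool _ _ _ rho (lk l rho) false
  (fun _ _ => true)) //.
congr ret; case: (lk l rho) => //= x s.
by elim: s.
Qed.

Lemma eval_app ctx (l1 l2 : var ctx LV) (rho : env R V ctx) :
  ev (app_prog l1 l2) rho = ret (catrev (lk l1 rho : seq V) (lk l2 rho : seq V)).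
Proof.
rewrite /app_prog (@eval_for_ret R V M _ TVertex LV _ _ _ rho (lk l1 rho) (lk l2 rho)
  (fun s y => y :: s)) //.
congr ret; elim: (lk l1 rho : seq V) (lk l2 rho : seq V) => //= y s IHs s'.
Qed.

Lemma eval_filter ctx t (l : var ctx (TList t)) (c : term [:: t, TList t & ctx] TBool)
    (rho : env R V ctx) (p : pred (den R V t)) :
  (forall x acc, ev c (x, (acc, rho)) = ret (p x)) ->
  ev (filter_prog l c) rho = ret (rev (filter p (lk l rho))).
Proof.
move=> cE; rewrite /filter_prog (@eval_for_ret R V M _ t (TList t) _ _ _ rho (lk l rho) [::]
  (fun s y => if p y then y :: s else s)) //.
  congr ret; rewrite /rev; move: [::] => a.
  elim: (lk l rho : seq (den R V t)) a => //= y s IHs a; rewrite IHs.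
  by case: (p y).
by move=> y s; rewrite /= cE /bind /=; case: (p y).
Qed.

Definition incident (b : V) (x : V * V * R) := (b == x.1.1) || (b == x.1.2).

Lemma eval_active ctx (vs : var ctx LV) (es : var ctx LE) (rho : env R V ctx) :
  ev (active_prog vs es) rho =
  ret (rev [seq b <- (lk vs rho : seq V) |
              has (incident b) (lk es rho : seq (V * V * R))]).
Proof.
rewrite /active_prog (@eval_filter _ TVertex _ _ rho (fun b =>
  has (incident b) (lk es rho : seq (V * V * R)))) // => b acc.
rewrite (@eval_for_ret R V M [:: TVertex, LV & ctx] edge TBool _ _ _
  (b, (acc, rho)) (lk es rho) false
  (fun c y => if incident b y then true else c)) //.
  congr ret; rewrite -[RHS]orbF; move: false => c.
  elim: (lk es rho : seq (V * V * R)) c => //= y s IHs c; rewrite IHs.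
  by case: (incident b y); rewrite ?orbT.
move=> y c; rewrite /= /bind /= /incident.
by case: (_ == _) => //=; case: (_ == _).
Qed.

Lemma sum_nat_const_seq (T : Type) (l : seq T) c : (\sum_(x <- l) c = size l * c)%N.
Proof. by rewrite big_const_seq count_predT iter_addn_0 mulnC. Qed.

Lemma runs_sum ctx (es : var ctx LE)
    (b : term [:: TReal, TVertex, TVertex, edge, TReal & ctx] TReal)
    (rho : env R V ctx) (h : V * V * R -> R) (c : V * V * R -> nat) :
  (forall (x : V * V * R) (acc : R), x \in (lk es rho : seq (V * V * R)) ->
    runs (ev b (x.2, (x.1.2, (x.1.1, (x, (acc, rho)))))) (eq^~ (acc + h x)) (c x) 0) ->
  runs (ev (sum_prog es b) rho)
    (eq^~ (\sum_(x <- (lk es rho : seq (V * V * R))) h x))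
    (1 + \sum_(x <- (lk es rho : seq (V * V * R))) c x)%N 0.
Proof.
move=> hb.
have := @runs_for R V M ctx edge TReal (Var es) (Numeral _ 0) _ rho (lk es rho)
  (fun l r => r = \sum_(x <- l) h x) c (fun _ => 0%N) 1 0 erefl _ _.
move=> /(_ (Let (Fst (Fst (Var V0))) (Let (Snd (Fst (Var V1))) (Let (Snd (Var V2)) b)))).
move=> H; apply: runs_weak (H _ _) _ _ _ => //.
- by split=> //=; rewrite big_nil.
- move=> l1 x l2 acc lE ->.
  apply: runs_let_ret; first by [].
  apply: runs_let_ret; first by [].
  apply: runs_let_ret; first by [].
  apply: runs_weak (hb x _ _) _ _ _ => //.
    by rewrite lE mem_cat inE eqxx orbT.
  by move=> r ->; rewrite -cats1 big_cat big_seq1.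
- by rewrite sum_nat_const_seq muln0.
Qed.

#[local] Arguments eval : simpl never.

Lemma runs_eq A (o : outcome A) x y c d c' : runs o (eq^~ x) c d -> x = y ->
  (c <= c')%N -> runs o (eq^~ y) c' d.
Proof. by move=> h <- lc; apply: runs_weak h _ _ _. Qed.

Lemma runs_add ctx (a b : term ctx TReal) (rho : env R V ctx) x y ca da cb db :
  runs (ev a rho) (eq^~ x) ca da -> runs (ev b rho) (eq^~ y) cb db ->
  runs (ev (Arith Add a b) rho) (eq^~ (x + y)) (ca + cb).+1 (da + db).
Proof. exact: runs_arith. Qed.

Lemma runs_varR ctx (x : var ctx TReal) (rho : env R V ctx) :
  runs (ev (Var x) rho) (eq^~ (lk x rho : R)) 0 0.
Proof. by []. Qed.

Lemma runs_cov ctx (es : var ctx LE) (S : var ctx LV) (rho : env R V ctx) :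
  runs (ev (cov_prog es S) rho)
    (eq^~ (cov (lk es rho : seq (V * V * R)) [set x in (lk S rho : seq V)]))
    (1 + size (lk es rho : seq (V * V * R))) 0.
Proof.
pose h (x : V * V * R) := x.2 *
  ((x.1.1 \in (lk S rho : seq V)) || (x.1.2 \in (lk S rho : seq V)))%:R.
apply: runs_eq (runs_sum (h := h) (c := fun=> 1%N) _) _ _; first last.
- by rewrite sum_nat_const_seq muln1.
- by apply: eq_bigr => x _; rewrite !inE.
move=> x acc _; rewrite /h.
eapply runs_if_ret; [exact: eval_mem | |] => /= uS.
  apply: runs_eq (runs_add (runs_varR V4 _) (runs_varR V0 _)) _ _ => //=.
  by rewrite uS mulr1.
rewrite (negPf uS); eapply runs_if_ret; [exact: eval_mem | |] => /= vS.
  apply: runs_eq (runs_add (runs_varR V4 _) (runs_varR V0 _)) _ _ => //=.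
  by rewrite vS mulr1.
apply: runs_eq (runs_varR V4 _) _ _ => //=.
by rewrite (negPf vS) mulr0 addr0.
Qed.

Lemma runs_phi ctx (es : var ctx LE) (S : var ctx LV) (rho : env R V ctx) :
  runs (ev (phi_prog es S) rho)
    (eq^~ (phi (lk es rho : seq (V * V * R)) [set x in (lk S rho : seq V)]))
    (1 + 3 * size (lk es rho : seq (V * V * R))) 0.
Proof.
pose s : seq V := lk S rho.
pose h (x : V * V * R) := x.2 *
  (((x.1.1 \in s) || (x.1.2 \in s)).*2 + ((x.1.1 \in s) && (x.1.2 \in s)))%:R.
apply: runs_eq (runs_sum (h := h) (c := fun=> 3) _) _ _; first last.
- by rewrite sum_nat_const_seq mulnC.
- by apply: eq_bigr => x _; rewrite !inE.
move=> x acc _; rewrite /h.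
pose rho' : env R V [:: TReal, TVertex, TVertex, edge, TReal & ctx] :=
  (x.2, (x.1.2, (x.1.1, (x, (acc, rho))))).
have acc2 := runs_add (runs_varR V4 rho')
  (runs_add (runs_varR V0 rho') (runs_varR V0 rho')).
eapply runs_if_ret; [exact: eval_mem | |] => /= uS.
  eapply runs_if_ret; [exact: eval_mem | |] => /= vS.
    apply: runs_eq (runs_add acc2 (runs_varR V0 _)) _ _ => //=.
    by rewrite [x.1.1 \in s]uS [x.1.2 \in s]vS (_ : (_ + _)%N = 3) //; lra.
  apply: runs_eq acc2 _ _ => //=.
  by rewrite [x.1.1 \in s]uS [x.1.2 \in s](negPf vS) (_ : (_ + _)%N = 2) //; lra.
eapply runs_if_ret; [exact: eval_mem | |] => /= vS.
  apply: runs_eq acc2 _ _ => //=.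
  by rewrite [x.1.1 \in s](negPf uS) [x.1.2 \in s]vS (_ : (_ + _)%N = 2) //; lra.
apply: runs_eq (runs_varR V4 _) _ _ => //=.
by rewrite [x.1.1 \in s](negPf uS) [x.1.2 \in s](negPf vS) (_ : (_ + _)%N = 0) //;
  lra.
Qed.

Lemma runs_if_eqV ctx t (a b : var ctx TVertex) (e1 e2 : term ctx t)
    (rho : env R V ctx) Q c d :
  (lk a rho = lk b rho -> runs (ev e1 rho) Q c d) ->
  ((lk a rho : V) != (lk b rho : V) -> runs (ev e2 rho) Q c d) ->
  runs (ev (If (EqVertex (Var a) (Var b)) e1 e2) rho) Q c d.
Proof.
move=> h1 h2; eapply runs_if_ret; first reflexivity.
  by move/eqP; exact: h1.
exact: h2.
Qed.

Lemma runs_gain ctx (es : var ctx LE) (S : var ctx LV) (b : var ctx TVertex)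
    (rho : env R V ctx) :
  wf_edges (lk es rho : seq (V * V * R)) ->
  runs (ev (gain_prog es S b) rho)
    (eq^~ (gain (lk es rho : seq (V * V * R)) [set x in (lk S rho : seq V)]
             (lk b rho)))
    (1 + \sum_(x <- (lk es rho : seq (V * V * R))) 2 * incident (lk b rho) x) 0.
Proof.
move=> wf; pose s : seq V := lk S rho; pose y : V := lk b rho.
pose h (x : V * V * R) := x.2 * ((y == x.1.1) * (1 + (x.1.2 \notin s))
  + (y == x.1.2) * (1 + (x.1.1 \notin s)))%:R.
apply: runs_eq (runs_sum (h := h) (c := fun x => (2 * incident y x)%N) _) _ _;
  first last.
- by [].
- by apply: eq_bigr => x _; rewrite !inE.
move=> x acc /wf [uv _]; rewrite /h.
pose rho' : env R V [:: TReal, TVertex, TVertex, edge, TReal & ctx] :=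
  (x.2, (x.1.2, (x.1.1, (x, (acc, rho))))).
have acc1 := runs_add (runs_varR V4 rho') (runs_varR V0 rho').
have acc2 := runs_add acc1 (runs_varR V0 rho').
rewrite /incident; eapply runs_if_eqV => /= [yu|yu].
  rewrite -[lk b rho]/y in yu; rewrite yu eqxx (negPf uv).
  eapply runs_if_ret; [exact: eval_mem | |] => /= vS.
    apply: runs_eq acc1 _ _ => //=.
    by rewrite [x.1.2 \in s]vS (_ : (_ + _)%N = 1) //; lra.
  apply: runs_eq acc2 _ _ => //=.
  by rewrite [x.1.2 \in s](negPf vS) (_ : (_ + _)%N = 2) //; lra.
rewrite -[lk b rho]/y in yu; rewrite (negPf yu); eapply runs_if_eqV => /= [yv|yv].
  rewrite -[lk b rho]/y in yv; rewrite yv eqxx.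
  eapply runs_if_ret; [exact: eval_mem | |] => /= uS.
    apply: runs_eq acc1 _ _ => //=.
    by rewrite [x.1.1 \in s]uS (_ : (_ + _)%N = 1) //; lra.
  apply: runs_eq acc2 _ _ => //=.
  by rewrite [x.1.1 \in s](negPf uS) (_ : (_ + _)%N = 2) //; lra.
rewrite -[lk b rho]/y in yv; rewrite (negPf yv).
by apply: runs_eq (runs_varR V4 _) _ _ => //=; rewrite (_ : (_ + _)%N = 0) //; lra.
Qed.

End Primitives.

#[local] Arguments eval : simpl never.

(** * Greedy sets and one round of local search *)

Section Step.
Variables (R : realType) (V : finType) (M : matroid V).
Notation ev e rho := (@eval R V M _ _ e rho).
Notation lk x rho := (@lookup R V _ _ x rho).
Local Notation mkset s := [set x in (s : seq V)].

Lemma runs_le A (o : outcome A) (Q : A -> Prop) c c' d d' :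
  runs o Q c d -> (c <= c')%N -> (d <= d')%N -> runs o Q c' d'.
Proof. by move=> h lc ld; apply: runs_weak h _ _ _. Qed.

(* [N] arises from [M] by contracting [b] and restricting to [u], so that it is
   queried by appending [b] to the list. *)
Definition is_contraction (N : matroid V) (u b : seq V) : Prop :=
  uniq u /\ forall X : {set V},
    (X \in indep N) = (X \subset mkset u) && (X :|: mkset b \in indep M).

Lemma eval_cons ctx t (e : term ctx t) (l : term ctx (TList t)) (rho : env R V ctx)
    (x : den R V t) (s : seq (den R V t)) :
  ev e rho = ret x -> ev l rho = ret s -> ev (ListCons e l) rho = ret (x :: s).
Proof. by rewrite /eval -/eval => -> ->. Qed.

Lemma set_query (x : V) (s b : seq V) :
  mkset (x :: catrev s b) = (x |: mkset s) :|: mkset b.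
Proof. by apply/setP=> y; rewrite !inE catrevE mem_cat mem_rev orbA. Qed.

Lemma indep_query N (u b s : seq V) x : is_contraction N u b ->
  {subset s <= u} -> x \in u ->
  (mkset (x :: catrev s b) \in indep M) = (x |: mkset s \in indep N).
Proof.
move=> [_ NE] su xu; rewrite NE set_query subUset sub1set inE xu /=.
by rewrite (_ : _ \subset _) //; apply/subsetP=> y; rewrite !inE => /su.
Qed.

(** A rejected vertex stays rejected, since the set only grows and independence is hereditary. The
    result is therefore maximal, and by augmentation of maximum size. *)
Lemma runs_greedy ctx (U B : var ctx LV) (rho : env R V ctx) N :
  is_contraction N (lk U rho) (lk B rho) ->
  mkset (lk B rho) \in indep M ->
  runs (ev (greedy_prog U B) rho)
    (fun S => [/\ uniq (S : seq V), mkset S \in indep N &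
       forall X, X \in indep N -> (#|X| <= size S)%N])
    0 (size (lk U rho : seq V)).
Proof.
move=> NE iB; have [uU NE'] := NE.
pose I (l S : seq V) := [/\ uniq S, {subset S <= l}, mkset S \in indep N &
  forall x, x \in l -> x \notin S -> x |: mkset S \notin indep N].
eapply runs_weak; first eapply (@runs_for R V M _ TVertex LV _ _ _ _ (lk U rho) I
  (fun=> 0%N) (fun=> 1%N)).
- by [].
- apply: runs_nil; split=> //.
  have set0E : mkset [::] = set0 by apply/setP=> x; rewrite !inE.
  by rewrite NE' set0E sub0set set0U.
- move=> l1 x l2 S UE [uS Sl iS maxS].
  have uUx : uniq (l1 ++ x :: l2) by rewrite -UE.
  have xl1 : x \notin l1.
    move: uUx; rewrite cat_uniq => /and3P[_ /hasPn/(_ x)].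
    by rewrite inE eqxx => /(_ isT).
  have xS : x \notin S by apply: contra xl1 => /Sl.
  have xU : x \in (lk U rho : seq V) by rewrite UE mem_cat inE eqxx orbT.
  have SU : {subset S <= (lk U rho : seq V)}.
    by move=> y /Sl yl; rewrite UE mem_cat yl.
  have iE := indep_query NE SU xU.
  have consE : mkset (x :: S) = x |: mkset S by apply/setP=> y; rewrite !inE.
  have sl : {subset S <= rcons l1 x}.
    by move=> y /Sl; rewrite mem_rcons inE => ->; rewrite orbT.
  eapply runs_if_indep.
  + by apply: eval_cons; [reflexivity | exact: eval_app].
  + move=> q; have {q} ix : x |: mkset S \in indep N by rewrite -iE.
    apply: runs_ret; first exact: eval_cons.
    split=> /=; first by rewrite xS.
    * by move=> y; rewrite inE => /orP[/eqP->|/sl//]; rewrite mem_rcons mem_head.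
    * by rewrite consE.
    move=> y; rewrite mem_rcons !inE negb_or.
    move=> /orP[/eqP->|yl /andP[yx yS]]; first by rewrite eqxx.
    apply: contra (maxS y yl yS); apply: indep_sub.
    by rewrite consE setUS // subsetUr.
  + move=> q; have {q} ix : x |: mkset S \notin indep N by rewrite -iE.
    apply: runs_var; split=> //.
    by move=> y; rewrite mem_rcons inE => /orP[/eqP->//|yl]; exact: maxS.
- by rewrite sum_nat_const_seq muln0.
- by rewrite sum_nat_const_seq muln1.
- move=> S [uS SU iS maxS]; split=> // X iX; rewrite leqNgt; apply/negP => cX.
  have [|x /setDP[xX]] := indep_aug iS iX; first by rewrite cardsE (card_uniqP uS).
  rewrite inE => xS ix; have xU : x \in (lk U rho : seq V).
    by move: iX; rewrite NE' => /andP[/subsetP/(_ _ xX)]; rewrite inE.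
  by have := maxS x xU xS; rewrite ix.
Qed.

(** As [S] itself is the initial candidate, the potential never drops, and its increase is a
    nonnegative bound on the effect of every swap. The summand 3 pays for the numeral that starts
    the gain, its addition to the potential of [S :\ a], and the comparison. *)
Lemma runs_step ctx (es : var ctx LE) (U B S : var ctx LV) (rho : env R V ctx) N :
  let e : seq (V * V * R) := lk es rho in
  let s : seq V := lk S rho in let u : seq V := lk U rho in
  wf_edges e -> is_contraction N u (lk B rho) ->
  uniq s -> mkset s \in indep N ->
  runs (ev (step_prog es U B S) rho)
    (fun p => [/\ uniq (p.2 : seq V), mkset p.2 \in indep N, size p.2 = size s,
       phi e (mkset s) <= phi e (mkset p.2) &
       forall a b, a \in s -> b \notin s -> b |: (mkset s :\ a) \in indep N ->
         phi e (b |: (mkset s :\ a)) <= phi e (mkset p.2)])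
    (1 + 3 * size e + size s * (1 + 3 * size e
      + \sum_(b <- u) (3 + \sum_(x <- e) 2 * incident b x)))
    (size s * size u).
Proof.
move=> e s u wf NE us iS; have [uu NE'] := NE.
pose I0 (p : R * seq V) := [/\ uniq p.2, mkset p.2 \in indep N, size p.2 = size s,
  p.1 = phi e (mkset p.2) & phi e (mkset s) <= p.1].
pose imp (p : R * seq V) a b := b \notin s -> b |: (mkset s :\ a) \in indep N ->
  phi e (b |: (mkset s :\ a)) <= p.1.
pose I (l : seq V) (p : R * seq V) := I0 p /\
  forall a b, a \in l -> b \in u -> imp p a b.
eapply runs_weak; first eapply (@runs_for R V M _ TVertex (TPair TReal LV)
  _ _ _ _ s I
  (fun=> (1 + 3 * size e + \sum_(b <- u) (3 + \sum_(x <- e) 2 * incident b x))%N)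
  (fun=> size u) (1 + 3 * size e)%N 0%N).
- by [].
- eapply runs_le; first eapply runs_let; first exact: runs_phi.
  + move=> q ->; eapply runs_pair; [reflexivity | reflexivity |].
    by split=> //; split=> //=; rewrite lexx.
  + by rewrite addn0.
  + by [].
- move=> l1 a l2 p sE [I0p impp].
  have as_ : a \in s by rewrite sE mem_cat inE eqxx orbT.
  eapply runs_let_ret.
    apply: (@eval_filter _ _ _ _ TVertex _ _ _ (fun x => x != a)) => x acc.
    by rewrite /eval -/eval /bind /=; case: eqVneq.
  set sa := rev _.
  have saP x : x \in sa = (x != a) && (x \in s) by rewrite mem_rev mem_filter.
  have sasub : {subset sa <= u}.
    move=> x; rewrite saP => /andP[_ xs].
    by move: iS; rewrite NE' => /andP[/subsetP/(_ x)]; rewrite !inE => ->.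
  have usa : uniq sa by rewrite rev_uniq filter_uniq.
  have saE : mkset sa = mkset s :\ a.
    by apply/setP=> x; rewrite !inE saP.
  have szsa : (size sa).+1 = size s.
    rewrite size_rev size_filter -(count_predC (pred1 a)).
    rewrite -[count (pred1 a) s]/(count_mem a s).
    by rewrite count_uniq_mem // as_.
  eapply runs_le; first eapply runs_let; first exact: runs_phi.
  + move=> q ->.
    pose J (l : seq V) (p' : R * seq V) := I l1 p' /\
      forall b, b \in l -> imp p' a b.
    eapply runs_weak; first eapply (@runs_for R V M _ TVertex (TPair TReal LV)
      _ _ _ _ u J
      (fun b => (3 + \sum_(x <- e) 2 * incident b x)%N) (fun=> 1%N) 0%N 0%N).
    * by [].
    * by apply: runs_var.
    move=> m1 b m2 p' uE [[I0p' impp'] impa].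
    have bu : b \in u by rewrite uE mem_cat inE eqxx orbT.
    (* The test is against [S :\ a], so [a] itself may be tried; this gives back [S] as a set and
       does no harm. *)
    eapply runs_if_ret; [exact: eval_mem | |] => /= bsa.
      eapply runs_le; [eapply runs_var | by [] | by []].
      split=> // c; rewrite mem_rcons inE => /orP[/eqP->|/impa//].
      by move=> bs; move: bsa; rewrite saP (negPf bs) andbF.
    eapply runs_le; first eapply runs_if_indep.
    + by apply: eval_cons; [reflexivity | exact: eval_app].
    + move=> iq.
      have {iq} ix : b |: mkset sa \in indep N.
        by rewrite -(indep_query NE sasub bu).
      pose rho' : env R V [:: TVertex, TPair TReal LV, TReal, LV, TVertex,
                             TPair TReal LV & ctx] :=
        (b, (p', (phi e (mkset sa), (sa, (a, (p, rho)))))).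
      pose es' := weaken [:: TVertex; TPair TReal LV; TReal; LV; TVertex;
                             TPair TReal LV] es.
      have wf' : wf_edges (lk es' rho') by [].
      have qE := runs_add (runs_varR M V2 rho') (runs_gain M V3 V0 wf').
      (* The potential of [S :\ a] is computed once per [a]; adding the gain of [b] replaces another
         sum over all edges. *)
      have vE : lk V2 rho' + gain (lk es' rho') (mkset (lk V3 rho')) (lk V0 rho')
          = phi e (b |: mkset sa).
        by rewrite phi_setU1 // inE.
      rewrite vE in qE.
      eapply runs_le; first eapply runs_let; first exact: qE.
      * move=> r ->; eapply (@runs_if_le R V M _ _ _ _ _ _ _
          p'.1 (phi e (b |: mkset sa)) _ 0 0 0 0 0 0).
        -- by [].
        -- by [].
        -- move=> lepr; eapply runs_pair;
             [reflexivity | by apply: eval_cons; reflexivity |].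
           have consE : mkset (b :: sa) = b |: mkset sa.
             by apply/setP=> y; rewrite !inE.
           have up a' b' : imp p' a' b' ->
               imp (phi e (b |: mkset sa), b :: sa) a' b'.
             by move=> h bs ix'; apply: le_trans (h bs ix') lepr.
           case: I0p' => [_ _ _ _ sp']; split; first split.
           ++ by split=> //=; rewrite ?bsa ?consE //; exact: le_trans sp' lepr.
           ++ by move=> a' b' al bu'; apply: up; exact: impp'.
           ++ move=> b'; rewrite mem_rcons inE => /orP[/eqP->|bm].
                2: by apply: up; exact: impa.
              by move=> _ _; rewrite /= -saE.
        -- move=> ltpr; apply: runs_var; split=> // b'.
           rewrite mem_rcons inE => /orP[/eqP->|]; last exact: impa.
           by move=> _ _; rewrite -saE ltW.
      * exact: leqnn.
      * exact: leqnn.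
    + move=> iq; apply: runs_var; split=> // b'.
      rewrite mem_rcons inE => /orP[/eqP->|]; last exact: impa.
      by move=> _; rewrite -saE -(indep_query NE sasub bu) (negPf iq).
    + by rewrite !add0n add1n addn1; exact: leqnn.
    + by [].
    + exact: leqnn.
    + exact: leqnn.
    + move=> p' [[I0p' impp'] impa]; split=> // a' b'.
      by rewrite mem_rcons inE => /orP[/eqP->|]; [exact: impa | exact: impp'].
  + by rewrite add0n; exact: leqnn.
  + by rewrite !add0n sum_nat_const_seq muln1.
- by rewrite sum_nat_const_seq.
- by rewrite sum_nat_const_seq.
- move=> p [[up ip sp pE lep] impp]; split=> //; first by rewrite -pE.
  move=> a b as_ bs ix; rewrite -pE; apply: impp => //.
  by move: ix; rewrite NE' => /andP[/subsetP/(_ b)]; rewrite !inE eqxx => /(_ isT).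
Qed.

(** With m edges, [u] has at most 2m vertices and the gains cost 4m beyond the constants. Hence the
    bound 4m + k(4m + 6m + 4m), which is at most 18mk as m and k are positive. *)
Lemma step_cost (es : seq (V * V * R)) (u : seq V) k :
  uniq u -> (forall b, b \in u -> has (incident b) es) ->
  (0 < size es)%N -> (0 < k)%N ->
  (1 + 3 * size es + k * (1 + 3 * size es
      + \sum_(b <- u) (3 + \sum_(x <- es) 2 * incident b x)) <= 18 * (size es * k))%N.
Proof.
move=> uu uact m0 k0.
have su : (size u <= 2 * size es)%N.
  have sub : {subset u <= [seq x.1.1 | x <- es] ++ [seq x.1.2 | x <- es]}.
    move=> b /uact/hasP[x xe].
    by rewrite mem_cat => /orP[]/eqP->; apply/orP; [left | right]; apply: map_f.
  by have := uniq_leq_size uu sub; rewrite size_cat !size_map addnn mul2n.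
have deg : (\sum_(b <- u) \sum_(x <- es) 2 * incident b x <= 4 * size es)%N.
  rewrite exchange_big /= [X in (_ <= X)%N]mulnC -sum_nat_const_seq.
  apply: leq_sum => x _.
  rewrite -big_distrr /= -[X in (_ <= X)%N]/(2 * 2)%N leq_mul2l /=.
  apply: (@leq_trans (\sum_(b <- u) ((b == x.1.1) + (b == x.1.2)))).
    by apply: leq_sum => b _; rewrite /incident; do 2!case: (_ == _).
  rewrite big_split /= -[X in (_ <= X)%N]/(1 + 1)%N; apply: leq_add.
    by rewrite -big_mkcond /= sum1_count count_uniq_mem // leq_b1.
  by rewrite -big_mkcond /= sum1_count count_uniq_mem // leq_b1.
rewrite big_split /= sum_nat_const_seq.
by nia.
Qed.

End Step.

(** * Repeated rounds, and the search starting from a greedy set *)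

Definition iter_prog ctx t (es : var ctx LE) (U B S0 : var ctx LV)
    (it : var ctx (TList t)) : term ctx LV :=
  Snd (For (Var it) (Pair (Var S0) (Var S0))
    (Let (Fst (Var V1))
    (Let (Snd (step_prog (weaken [:: LV; t; TPair LV LV] es)
                 (weaken [:: LV; t; TPair LV LV] U)
                 (weaken [:: LV; t; TPair LV LV] B) V0))
    (Let (Snd (Var V3))
    (If (Le (cov_prog (weaken [:: LV; LV; LV; t; TPair LV LV] es) V0)
            (cov_prog (weaken [:: LV; LV; LV; t; TPair LV LV] es) V1))
        (Pair (Var V1) (Var V1)) (Pair (Var V1) (Var V0))))))).

Definition search_prog ctx t (es : var ctx LE) (vs B : var ctx LV)
    (it : var ctx (TList t)) : term ctx LV :=
  Let (active_prog vs es)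
  (Let (greedy_prog V0 (weaken [:: LV] B))
  (If (nonempty_prog V0)
     (iter_prog (weaken [:: LV; LV] es) V1 (weaken [:: LV; LV] B) V0
        (weaken [:: LV; LV] it))
     (Var V0))).

Section Iteration.
Variables (R : realType) (V : finType) (M : matroid V).
Notation ev e rho := (@eval R V M _ _ e rho).
Notation lk x rho := (@lookup R V _ _ x rho).
Local Notation mkset s := [set x in (s : seq V)].

(** The state pairs the current set, driven by the potential, with the best set so far, judged by
    coverage, because a swap that raises the potential may lower the coverage. [slack] in [I] is the
    telescoped sum of the inequalities of [local_search_step]. *)
Lemma runs_iter ctx t (es : var ctx LE) (U B S0 : var ctx LV)
    (it : var ctx (TList t)) (rho : env R V ctx) N :
  let e : seq (V * V * R) := lk es rho in
  let s0 : seq V := lk S0 rho in let u : seq V := lk U rho in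
  let k := size s0 in let T := size (lk it rho) in
  wf_edges e -> is_contraction M N u (lk B rho) ->
  (forall b, b \in u -> has (incident b) e) -> (0 < size e)%N ->
  uniq s0 -> mkset s0 \in indep N -> (0 < k)%N ->
  (forall X, X \in indep N -> (#|X| <= k)%N) ->
  runs (ev (iter_prog es U B S0 it) rho)
    (fun S => mkset S \in indep N /\ forall O, O \in indep N ->
       2 * T%:R * cov e O <= 3 * (T + k)%:R * cov e (mkset S))
    (T * (23 * (size e * k))) (T * (k * size u)).
Proof.
move=> e s0 u k T wf NE uact m0 us0 is0 k0 kmax.
pose I (l : seq (den R V t)) (st : seq V * seq V) :=
  [/\ uniq st.1, mkset st.1 \in indep N, size st.1 = k,
   mkset st.2 \in indep N & cov e (mkset st.1) <= cov e (mkset st.2) /\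
   forall O, O \in indep N -> (size l)%:R * (2 * cov e O - 3 * cov e (mkset st.2))
     <= k%:R * phi e (mkset st.1)].
eapply runs_snd; first eapply runs_le.
- apply: (@runs_for R V M _ t (TPair LV LV) _ _ _ _ (lk it rho) I
  (fun=> (23 * (size e * k))%N) (fun=> (k * size u)%N) 0%N 0%N).
  + by [].
  + eapply runs_pair; [reflexivity | reflexivity |].
    split=> //; split=> // O _.
    by rewrite mul0r mulr_ge0 // phi_ge0.
  move=> l1 x l2 [S Sb] _ [/= uS iS szS iSb [covS slack]].
  apply: (@runs_let_ret R V M [:: t, TPair LV LV & ctx] LV (TPair LV LV) _ _
    (x, ((S, Sb), rho)) S); first by [].
  eapply runs_le; first eapply runs_let.
  + pose Q1 (S1 : seq V) := [/\ uniq S1, mkset S1 \in indep N, size S1 = size S,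
      phi e (mkset S) <= phi e (mkset S1) &
      forall a b, a \in S -> b \notin S -> b |: (mkset S :\ a) \in indep N ->
        phi e (b |: (mkset S :\ a)) <= phi e (mkset S1)].
    eapply (@runs_snd R V M _ TReal LV _ _ _ Q1).
      by apply: (runs_step (N := N)).
    by move=> p; exact.
  + move=> S1 [uS1 iS1 szS1 phiS1 opt].
    apply: (@runs_let_ret R V M [:: LV, LV, t, TPair LV LV & ctx] LV (TPair LV LV) _ _
      (S1, (S, (x, ((S, Sb), rho)))) Sb); first by [].
    have step O : O \in indep N -> 2 * cov e O - 3 * cov e (mkset S)
        <= k%:R * (phi e (mkset S1) - phi e (mkset S)).
      move=> iO; have cS : #|mkset S| = k by rewrite cardsE (card_uniqP uS).
      rewrite -cS; apply: (local_search_step (M := N)) => //.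
      - by rewrite cS; exact: kmax.
      - by rewrite subr_ge0.
      move=> a b; rewrite !inE => aS bS ix; rewrite addrC subrK.
      exact: opt.
    have slack' c : cov e (mkset Sb) <= c -> forall O, O \in indep N ->
        (size (rcons l1 x))%:R * (2 * cov e O - 3 * c) <= k%:R * phi e (mkset S1).
      move=> lec O iO; rewrite size_rcons -natr1.
      have h1 := slack O iO; have h2 := step O iO.
      have h3 : (size l1)%:R * (2 * cov e O - 3 * c) <=
          (size l1)%:R * (2 * cov e O - 3 * cov e (mkset Sb)).
        by apply: ler_wpM2l => //; lra.
      by rewrite mulrDl mul1r; lra.
    pose rho' : env R V [:: LV, LV, LV, t, TPair LV LV & ctx] :=
      (Sb, (S1, (S, (x, ((S, Sb), rho))))).
    pose es' := weaken [:: LV; LV; LV; t; TPair LV LV] es.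
    have covR : runs (ev (cov_prog es' V0) rho')
        (eq^~ (cov e (mkset Sb))) (1 + size e) 0.
      exact: (runs_cov M es' V0 rho').
    have covR1 : runs (ev (cov_prog es' V1) rho')
        (eq^~ (cov e (mkset S1))) (1 + size e) 0.
      exact: (runs_cov M es' V1 rho').
    apply: (runs_if_le covR covR1 (c := 0) (d := 0)).
    * move=> le1; eapply runs_pair; [reflexivity | reflexivity |].
      split=> //=; first by rewrite szS1.
      by split=> //; exact: slack'.
    * move=> /ltW lt1; eapply runs_pair; [reflexivity | reflexivity |].
      split=> //=; first by rewrite szS1.
      by split=> //; exact: slack'.
  (* Two coverages and their comparison cost 2m + 3, at most 5m; this raises 18 to 23. *)
  + have kS : (0 < size S)%N by rewrite szS.
    apply: leq_trans (leq_add (step_cost (proj1 NE) uact m0 kS) (leqnn _)) _.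
    by rewrite szS; nia.
  + apply: (@leq_trans (size S * size u + (0 + 0 + 0))); first exact: leqnn.
    by rewrite szS !addn0.
- by rewrite add0n sum_nat_const_seq.
- by rewrite add0n sum_nat_const_seq.
- move=> [S Sb] [/= uS iS szS iSb [covS slack]]; split=> // O iO.
  have := slack O iO; have := phi_le_cov (mkset S) wf.
  have : k%:R * phi e (mkset S) <= k%:R * (3 * cov e (mkset Sb)).
    by apply: ler_wpM2l => //; have := phi_le_cov (mkset S) wf; lra.
  by rewrite natrD; lra.
Qed.

End Iteration.

Section Search.
Variables (R : realType) (V : finType) (M : matroid V).
Notation ev e rho := (@eval R V M _ _ e rho).
Notation lk x rho := (@lookup R V _ _ x rho).
Local Notation mkset s := [set x in (s : seq V)].

Lemma cov_active (e : seq (V * V * R)) (A O : {set V}) :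
  (forall x, x \in e -> x.1.1 \in A /\ x.1.2 \in A) -> cov e (O :&: A) = cov e O.
Proof.
move=> eA; apply: eq_big_seq => x /eA[h1 h2].
by rewrite !inE h1 h2 !andbT.
Qed.

Lemma cov0 (e : seq (V * V * R)) : cov e set0 = 0.
Proof. by apply: big1 => x _; rewrite !inE mulr0. Qed.

(** [K] bounds the rank of the contracted matroid on the active vertices, which may be smaller. As
    no edge meets [b], the active vertices are disjoint from [b] and the contraction is defined. *)
Lemma runs_search ctx t (es : var ctx LE) (vs B : var ctx LV)
    (it : var ctx (TList t)) (rho : env R V ctx) K :
  let e : seq (V * V * R) := lk es rho in
  let v : seq V := lk vs rho in let b : seq V := lk B rho in
  let T := size (lk it rho) in
  wf_edges e -> uniq v -> (forall x, x \in v) -> mkset b \in indep M ->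
  (forall x y, x \in e -> y \in b -> ~~ incident y x) ->
  (forall X : {set V}, (forall y, y \in X -> has (incident y) e) ->
    X :|: mkset b \in indep M -> (#|X| <= K)%N) ->
  runs (ev (search_prog es vs B it) rho)
    (fun S => [/\ mkset S :|: mkset b \in indep M,
       (forall y, y \in (S : seq V) -> has (incident y) e) &
       forall O, O :|: mkset b \in indep M ->
       2 * T%:R * cov e O <= 3 * (T + K)%:R * cov e (mkset S)])
    (T * (23 * (size e * K))) (size v + T * (K * size v)).
Proof.
move=> e v b T wf uv vT ib eb Kmax.
pose u := rev [seq y <- v | has (incident y) e].
have uE y : (y \in u) = has (incident y) e by rewrite mem_rev mem_filter vT andbT.
have ub : [disjoint mkset u & mkset b].
  rewrite -setI_eq0; apply/eqP/setP=> y; rewrite !inE uE.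
  apply/negP=> /andP[/hasP[x xe yx] yb].
  by have := eb x y xe yb; rewrite yx.
pose N := contraction ub ib.
have uu : uniq u by rewrite rev_uniq filter_uniq.
have NE : is_contraction M N u b by split=> // X; rewrite inE.
have Nb X : X \in indep N -> X \subset mkset u /\ X :|: mkset b \in indep M.
  by rewrite (proj2 NE) => /andP[].
have NK X : X \in indep N -> (#|X| <= K)%N.
  move=> /Nb[/subsetP Xu iX]; apply: Kmax => // y /Xu.
  by rewrite inE uE.
have szu : (size u <= size v)%N by rewrite size_rev size_filter count_size.
apply: (@runs_let_ret R V M ctx LV LV _ _ rho u); first exact: eval_active.
pose rho1 : env R V [:: LV & ctx] := (u, rho).
have gr := runs_greedy (U := V0) (B := weaken [:: LV] B) (rho := rho1) NE ib.
eapply runs_le; first eapply (runs_let gr).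
- move=> S0 [uS0 iS0 maxS0].
  have [Su Sb] := Nb _ iS0.
  have Sact y : y \in (S0 : seq V) -> has (incident y) e.
    by move=> yS; rewrite -uE; move/subsetP: Su => /(_ y); rewrite !inE => ->.
  have covN O : O :|: mkset b \in indep M ->
      exists2 O', O' \in indep N & cov e O' = cov e O.
    move=> iO; exists (O :&: mkset u).
      rewrite (proj2 NE) subsetIr; apply: indep_sub iO; apply: setSU; exact: subsetIl.
    apply: cov_active => x xe; rewrite !inE !uE.
    by split; apply/hasP; exists x; rewrite // /incident eqxx ?orbT.
  pose rho2 : env R V [:: LV, LV & ctx] := (S0, (u, rho)).
  have cS0 : #|mkset S0| = size S0 by rewrite cardsE (card_uniqP uS0).
  apply: (@runs_if_ret R V M [:: LV, LV & ctx] LV _ _ _ rho2 _ _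
    (T * (23 * (size e * K))) (T * (K * size v)) (eval_nonempty M _ _)) => /= S0n.
  + have k0 : (0 < size (S0 : seq V))%N by rewrite lt0n.
    have kK : (size (S0 : seq V) <= K)%N by rewrite -cS0 NK.
    have m0 : (0 < size e)%N.
      case: (S0 : seq V) k0 Sact => // y S' _ /(_ y (mem_head _ _)).
      by case/hasP=> x xe _; rewrite -has_predT; apply/hasP; exists x.
    have uact y : y \in u -> has (incident y) e by rewrite uE.
    pose es' := weaken [:: LV; LV] es.
    have := @runs_iter R V M _ _ es' V1 (weaken [:: LV; LV] B) V0
      (weaken [:: LV; LV] it) rho2 N wf NE uact m0 uS0 iS0 k0 maxS0.
    move=> H; apply: runs_weak H _ _ _.
    * by rewrite !leq_mul2l kK !orbT.
    * by rewrite leq_mul2l; apply/orP; right; apply: leq_mul.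
    move=> S [iS opt]; have [Su' Sb'] := Nb _ iS; split=> //.
      by move=> y yS; rewrite -uE; move/subsetP: Su' => /(_ y); rewrite !inE => ->.
    move=> O /covN[O' iO' <-]; apply: le_trans (opt O' iO') _.
    apply: ler_wpM2r; first exact: cov_ge0.
    by apply: ler_wpM2l => //; rewrite ler_nat leq_add2l.
  (* An empty greedy set means that no active vertex can be added, so every competitor covers
     nothing. *)
  + eapply runs_le; [eapply runs_var | by [] | by []].
    split=> // O /covN[O' iO' <-].
    move: (maxS0 _ iO'); move: S0n; rewrite negbK /nilp => /eqP->.
    rewrite leqn0 cards_eq0 => /eqP->; rewrite cov0 mulr0.
    by apply: mulr_ge0; [apply: mulr_ge0 | apply: cov_ge0].
- by rewrite add0n.
- by rewrite leq_add2r.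
Qed.

End Search.

(** * Guessing one vertex of the optimum *)

Definition guess_prog ctx t (es : var ctx LE) (vs : var ctx LV)
    (it : var ctx (TList t)) (v : var ctx TVertex) (acc : var ctx LV) : term ctx LV :=
  Let (ListCons (Var v) (ListNil _ _))
  (If (Indep (Var V0))
    (Let (filter_prog (weaken [:: LV] es)
            (If (incident_prog (weaken [:: edge; LE; LV] v) V0)
               (Bool _ false) (Bool _ true)))
    (Let (ListCons (Var (weaken [:: LE; LV] v))
            (search_prog V0 (weaken [:: LE; LV] vs) V1 (weaken [:: LE; LV] it)))
    (If (Le (cov_prog (weaken [:: LV; LE; LV] es) (weaken [:: LV; LE; LV] acc))
            (cov_prog (weaken [:: LV; LE; LV] es) V0))
       (Var V0) (Var (weaken [:: LV; LE; LV] acc)))))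
    (Var (weaken [:: LV] acc))).

(** A loop counter for twice the square of the size of [S]: the number of rounds depends on the
    rank, which the program has to find out itself. *)
Definition square_prog ctx (S : var ctx LV) : term ctx (TList TBool) :=
  For (Var S) (ListNil _ _)
    (For (Var (weaken [:: TVertex; TList TBool] S)) (Var V1)
       (ListCons (Bool _ true) (ListCons (Bool _ true) (Var V1)))).

Fixpoint repeat_prog ctx (T : nat) : term ctx (TList TBool) :=
  if T is T'.+1 then ListCons (Bool _ true) (repeat_prog ctx T') else ListNil _ _.

Definition approx_program (T : nat) : program :=
  Let (ListNil _ TVertex) (Let (repeat_prog _ T) (search_prog V2 V3 V1 V0)).

Definition exact_program : program :=
  Let (ListNil _ TVertex)
  (Let (active_prog V2 V1)
  (Let (greedy_prog V0 V1)
  (Let (square_prog V0)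
  (For (Var V2) (ListNil _ _) (guess_prog V6 V7 V2 V0 V1))))).

Section Guess.
Variables (R : realType) (V : finType) (M : matroid V).
Notation ev e rho := (@eval R V M _ _ e rho).
Notation lk x rho := (@lookup R V _ _ x rho).
Local Notation mkset s := [set x in (s : seq V)].
Implicit Types (e : seq (V * V * R)) (O : {set V}).

Lemma eval_repeat ctx T (rho : env R V ctx) :
  ev (repeat_prog ctx T) rho = ret (nseq T true).
Proof.
elim: T => //= T IH.
exact: (@eval_cons R V M ctx TBool _ _ rho true (nseq T true)).
Qed.

Lemma eval_square ctx (S : var ctx LV) (rho : env R V ctx) :
  exists2 s : seq bool, ev (square_prog S) rho = ret s &
    size s = (2 * size (lk S rho : seq V) ^ 2)%N.
Proof.
pose F (a : seq bool) (x : V) :=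
  foldl (fun b (y : V) => [:: true, true & b]) a (lk S rho).
exists (foldl F [::] (lk S rho)).
  apply: (@eval_for_ret R V M ctx TVertex (TList TBool) _ _ _ rho
    (lk S rho) [::] F) => // x a.
  exact: (@eval_for_ret R V M [:: TVertex, TList TBool & ctx] TVertex (TList TBool)
    _ _ _ (x, (a, rho)) (lk S rho) a).
have szF a x : size (F a x) = (size a + 2 * size (lk S rho : seq V))%N.
  rewrite /F; elim: (lk S rho : seq V) a => [|y l IHl] a /=; first by rewrite addn0.
  by rewrite IHl /=; lia.
have szfold l a : size (foldl F a l) =
    (size a + size l * (2 * size (lk S rho : seq V)))%N.
  by elim: l a => [|y l IHl] a /=; [rewrite mul0n addn0 | rewrite IHl szF; lia].
by rewrite szfold -mulnn mulnCA.
Qed.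

Lemma runs_cons ctx t (a : term ctx t) (l : term ctx (TList t)) (rho : env R V ctx)
    (x : den R V t) P (Q : den R V (TList t) -> Prop) c d :
  ev a rho = ret x -> runs (ev l rho) P c d -> (forall s, P s -> Q (x :: s)) ->
  runs (ev (ListCons a l) rho) Q c d.
Proof.
rewrite /eval -/eval => -> [p hc hd] PQ; split; rewrite /= ?addn0 //.
exact: PQ.
Qed.

(** The equality is exact because deleting the edges at [y] removes precisely those that would be
    counted twice. *)
Lemma cov_setU1 e (y : V) (X : {set V}) :
  cov e (y |: X) = cov e [set y] + cov [seq x <- e | ~~ incident y x] X.
Proof.
rewrite /cov big_filter [X in _ = _ + X]big_mkcond -big_split /=.
apply: eq_bigr => x _.
rewrite /incident !inE -!(eq_sym y).
by do 2!case: (y == _) => /=; rewrite ?orbT ?mulr0 ?addr0 ?add0r.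
Qed.

Lemma cov_subadd e O : wf_edges e -> cov e O <= \sum_(y in O) cov e [set y].
Proof.
move=> wf; rewrite /cov exchange_big /= !big_seq.
apply: ler_sum => -[[u v] w] /wf[/= uv w0].
rewrite -big_distrr /=; apply: ler_wpM2l => //.
rewrite -natr_sum ler_nat.
case: (boolP (u \in O)) => uO /=.
  by rewrite (bigD1 u) //= inE eqxx.
case: (boolP (v \in O)) => //= vO.
by rewrite (bigD1 v) //= !inE eqxx orbT.
Qed.

(** By subadditivity, the vertex of [O] with the largest coverage has at least the average share. *)
Lemma heavy_vertex e O : wf_edges e -> O != set0 ->
  exists2 y, y \in O & cov e O <= #|O|%:R * cov e [set y].
Proof.
move=> wf /set0Pn[y0 y0O].
case: (arg_maxP (fun y => cov e [set y]) y0O) => y yO ymax.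
exists y => //; apply: le_trans (cov_subadd O wf) _.
rewrite mulr_natl -sumr_const; exact: ler_sum.
Qed.

(* [d] is covered by the guessed vertex, [c] and [o] are the further coverages of
   the computed and of the optimal set. The bound on [T] is what makes
   [2 K o <= (T + K) d], since [o <= K d]. *)
Lemma guess_bound (T K : nat) (d c o : R) : 0 <= d -> 0 <= c ->
  (2 * K ^ 2 <= T)%N -> d + o <= K%:R * d ->
  2 * T%:R * o <= 3 * (T + K)%:R * c -> 2 * (d + o) <= 3 * (d + c).
Proof.
move=> d0 c0 TK oK; rewrite natrD; have TK' : 2 * K%:R ^+ 2 <= T%:R :> R.
  by rewrite -natrX -natrM ler_nat.
have k0 : 0 <= K%:R :> R := ler0n _ _; have t0 : 0 <= T%:R :> R := ler0n _ _.
move=> opt; have [K0|K0] := posnP K.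
  by move: oK; rewrite K0 mul0r => oK; lra.
have tk : 0 < T%:R + K%:R :> R by rewrite ltr_wpDl // ltr0n.
suff : 2 * o <= d + 3 * c by lra.
rewrite -(ler_pM2l tk).
have h1 : K%:R * o <= K%:R * (K%:R * d) by apply: ler_wpM2l => //; lra.
have h2 : 2 * K%:R ^+ 2 * d <= T%:R * d by apply: ler_wpM2r.
have h3 : 0 <= K%:R * d by apply: mulr_ge0.
by nra.
Qed.

(** The guarantee concerns only those [O] in which [y] is heavy. The coverage of the accumulator
    never decreases, so the guarantees of earlier guesses survive. *)
Lemma runs_guess ctx t (es : var ctx LE) (vs : var ctx LV)
    (it : var ctx (TList t)) (v : var ctx TVertex) (acc : var ctx LV)
    (rho : env R V ctx) K :
  let e : seq (V * V * R) := lk es rho in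
  let vv : seq V := lk vs rho in let y : V := lk v rho in
  let a : seq V := lk acc rho in let T := size (lk it rho) in
  wf_edges e -> uniq vv -> (forall x, x \in vv) -> has (incident y) e ->
  (2 * K ^ 2 <= T)%N -> mkset a \in indep M ->
  (forall X : {set V}, (forall z, z \in X -> has (incident z) e) ->
    X \in indep M -> (#|X| <= K)%N) ->
  runs (ev (guess_prog es vs it v acc) rho)
    (fun S => [/\ mkset S \in indep M, cov e (mkset a) <= cov e (mkset S) &
       forall O, O \in indep M -> y \in O -> cov e O <= K%:R * cov e [set y] ->
       2 * cov e O <= 3 * cov e (mkset S)])
    (K * (T * (23 * size e) + 5 * size e)) (1 + (size vv + T * (K * size vv))).
Proof.
move=> e vv y a T wf uvv vvT yact TK ia Kmax.
have set1E : mkset [:: y] = [set y] by apply/setP=> z; rewrite !inE.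
apply: (@runs_let_ret R V M ctx LV LV _ _ rho [:: y]); first by [].
pose rho1 : env R V [:: LV & ctx] := ([:: y], rho).
eapply runs_le; first apply: (@runs_if_indep R V M [:: LV & ctx] LV _ _ _ rho1
  [:: y] _ (K * (T * (23 * size e) + 5 * size e)) (size vv + T * (K * size vv))); last 2 first.
- exact: leqnn.
- by rewrite add1n.
- by [].
- rewrite set1E => iy.
  pose e' := rev [seq x <- e | ~~ incident y x].
  have e'e x : x \in e' = ~~ incident y x && (x \in e) by rewrite mem_rev mem_filter.
  apply: (@runs_let_ret R V M [:: LV & ctx] LE LV _ _ rho1 e').
    apply: (@eval_filter R V M [:: LV & ctx] edge _ _ rho1
      (fun x => ~~ incident y x)) => x acc'.
    rewrite /eval -/eval /bind /= /incident.
    by case: (_ == _) => //=; case: (_ == _).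
  pose rho2 : env R V [:: LE, LV & ctx] := (e', rho1).
  have wf' : wf_edges e' by move=> x; rewrite e'e => /andP[_ /wf].
  (* An independent singleton forces [K] and the number of edges to be positive, so the two
     coverages and their comparison fit into 5m, hence into 5mK. A dependent singleton costs no
     arithmetic. *)
  have K0 : (0 < K)%N.
    have := Kmax [set y]; rewrite cards1; apply=> // z; by rewrite inE => /eqP->.
  have m0 : (0 < size e)%N.
    by case/hasP: yact => x xe _; rewrite -has_predT; apply/hasP; exists x.
  have se' : (size e' <= size e)%N by rewrite size_rev size_filter count_size.
  have act' z : has (incident z) e' -> has (incident z) e.
    by case/hasP=> x; rewrite e'e => /andP[_ xe] zx; apply/hasP; exists x.
  have sr : runs (ev (search_prog V0 (weaken [:: LE; LV] vs) V1
                        (weaken [:: LE; LV] it)) rho2)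
      (fun S => [/\ mkset S :|: mkset [:: y] \in indep M,
       (forall z, z \in (S : seq V) -> has (incident z) e') &
       forall O, O :|: mkset [:: y] \in indep M ->
       2 * T%:R * cov e' O <= 3 * (T + K)%:R * cov e' (mkset S)])
    (T * (23 * (size e' * K))) (size vv + T * (K * size vv)).
    apply: (@runs_search R V M [:: LE, LV & ctx] t V0 _ V1 _ rho2 K) => //.
    - by rewrite set1E.
    - by move=> x z; rewrite e'e inE => /andP[h _] /eqP->.
    - move=> X Xact iX; apply: Kmax => [z /Xact/act'//|].
      by apply: indep_sub iX; exact: subsetUl.
  pose Q1 (c : seq V) := exists2 r : seq V, c = y :: r &
    y |: mkset r \in indep M /\ forall O, y |: O \in indep M ->
      2 * T%:R * cov e' O <= 3 * (T + K)%:R * cov e' (mkset r).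
  eapply runs_le; first eapply (@runs_let R V M [:: LE, LV & ctx] LV LV _ _ rho2 Q1).
  + apply: (@runs_cons [:: LE, LV & ctx] TVertex (Var (weaken [:: LE; LV] v)) _
      rho2 y _ Q1 _ _ _ sr) => // r [ir _ opt]; exists r => //.
    rewrite set1E in ir opt; split=> [|O iO]; first by rewrite setUC.
    by apply: opt; rewrite setUC.
  + move=> _ [r -> [ir opt]].
    have consE : mkset (y :: r) = y |: mkset r by apply/setP=> z; rewrite !inE.
    pose rho3 : env R V [:: LV, LE, LV & ctx] := (y :: r, rho2).
    pose es3 := weaken [:: LV; LE; LV] es.
    have covR : runs (ev (cov_prog es3 (weaken [:: LV; LE; LV] acc)) rho3)
      (eq^~ (cov e (mkset a))) (1 + size e) 0 by exact: (runs_cov M es3 _ rho3).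
    have covR1 : runs (ev (cov_prog es3 V0) rho3)
      (eq^~ (cov e (mkset (y :: r)))) (1 + size e) 0.
      exact: (runs_cov M es3 V0 rho3).
    have opt' O : O \in indep M -> y \in O -> cov e O <= K%:R * cov e [set y] ->
       2 * cov e O <= 3 * cov e (mkset (y :: r)).
      move=> iO yO; have covE X : cov e (y |: X) = cov e [set y] + cov e' X.
        by rewrite cov_setU1; congr (_ + _); apply: perm_big; rewrite perm_sym perm_rev.
      have OE : y |: O = O by apply/setUidPr; rewrite sub1set.
      rewrite consE -OE !covE => oK.
      apply: (guess_bound (T := T) (K := K)) => //; try exact: cov_ge0.
      by apply: opt; rewrite OE.
    apply: (runs_if_le covR covR1 (c := 0) (d := 0)) => [le1|/ltW lt1]; apply: runs_var.
      by rewrite -consE in ir; split.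
    split=> // O iO yO oK; apply: le_trans (opt' O iO yO oK) _.
    by apply: ler_wpM2l.
  + have : (T * (23 * (size e' * K)) <= T * (23 * (size e * K)))%N.
      by rewrite !leq_mul2l leq_mul2r se' !orbT.
    move=> h; apply: leq_trans (leq_add h (leqnn _)) _.
    by rewrite mulnDr; nia.
  + by rewrite !addn0.
- rewrite set1E => iy; eapply runs_le; [eapply runs_var | by [] | by []].
  split=> // O iO yO; case/negP: iy; apply: indep_sub iO; by rewrite sub1set.
Qed.

End Guess.

(** * The two algorithms *)

Section Main.
Variables (R : realType) (V : finType) (G : wgraph R V) (M : matroid V).
Variables (vs : seq V) (es : seq (V * V * R)).
Hypothesis io : input_of G vs es.
Local Notation mkset s := [set x in (s : seq V)].

Lemma input_wf : wf_edges es.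
Proof.
case: io => _ pe x xe.
have : ([set x.1.1; x.1.2], x.2) \in [seq (e, weight G e) | e <- enum (edges G)].
  by rewrite -(perm_mem pe); apply/mapP; exists x.
case/mapP=> e; rewrite mem_enum => eG [eE ->]; split; last exact: weight_ge0.
by have := edges_card2 eG; rewrite -eE cards2; case: eqP.
Qed.

Lemma input_cov X : coverage G X = cov es X.
Proof.
case: io => _ pe; rewrite /coverage -big_enum_cond /=.
pose f (p : {set V} * R) := p.2 * (~~ [disjoint p.1 & X])%:R.
transitivity (\sum_(p <- [seq (e, weight G e) | e <- enum (edges G)]) f p).
  rewrite big_map big_mkcond; apply: eq_bigr => e _; rewrite /f /=.
  by case: (~~ _); rewrite ?mulr1 ?mulr0.
rewrite -(perm_big _ pe) big_map; apply: eq_bigr => x _; rewrite /f /=.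
congr (_ * (nat_of_bool _)%:R).
apply/idP/idP => [/pred0Pn[z /andP[]]|].
  by rewrite !inE => /orP[]/eqP-> ->; rewrite ?orbT.
by case/orP=> h; apply/pred0Pn; [exists x.1.1 | exists x.1.2];
  rewrite /= !inE eqxx ?orbT.
Qed.

Lemma input_size_es : size es = #|edges G|.
Proof. by case: io => _ /perm_size; rewrite !size_map -cardE. Qed.

Lemma input_uniq : uniq vs.
Proof. by case: io => /perm_uniq-> _; exact: enum_uniq. Qed.

Lemma input_mem x : x \in vs.
Proof. by case: io => /perm_mem-> _; rewrite mem_enum. Qed.

Lemma input_size_vs : size vs = #|V|.
Proof. by case: io => /perm_size-> _; rewrite -cardE. Qed.

Lemma card_le_mrank X : X \in indep M -> (#|X| <= mrank M)%N.
Proof. by move=> iX; rewrite /mrank (bigD1 X iX) leq_maxl. Qed.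

Lemma max_coverage_le (c : R) : 0 <= c ->
  (forall X, X \in indep M -> coverage G X <= c) -> max_coverage G M <= c.
Proof. by move=> c0 h; apply: bigmax_le. Qed.

Lemma run_runs (P : program) Q c d :
  runs (eval M P ((es, (vs, tt)) : env R V input_ctx)) (fun S => Q (mkset S)) c d ->
  runs (run M P vs es) Q c d.
Proof. by case=> q hc hd; split; rewrite /= ?addn0. Qed.

Lemma runs_approx T :
  runs (run M (approx_program T) vs es)
    (fun S => S \in indep M /\ forall O, O \in indep M ->
      2 * T%:R * cov es O <= 3 * (T + mrank M)%:R * cov es S)
    (T * (23 * (size es * mrank M))) (size vs + T * (mrank M * size vs)).
Proof.
have set0E : mkset [::] = set0 by apply/setP=> z; rewrite !inE.
apply: run_runs.
apply: (@runs_let_ret R V M input_ctx LV LV _ _ (es, (vs, tt)) [::]); first by [].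
apply: (@runs_let_ret R V M [:: LV & input_ctx] (TList TBool) LV _ _
  ([::], (es, (vs, tt))) (nseq T true)); first exact: eval_repeat.
pose rho : env R V [:: TList TBool, LV & input_ctx] :=
  (nseq T true, ([::], (es, (vs, tt)))).
eapply runs_weak;
  first apply: (@runs_search R V M [:: TList TBool, LV & input_ctx] TBool
  V2 V3 V1 V0 rho (mrank M)).
- exact: input_wf.
- exact: input_uniq.
- exact: input_mem.
- by rewrite set0E indep0.
- by move=> x y _; rewrite in_nil.
- by move=> X _; rewrite set0E setU0; exact: card_le_mrank.
- by rewrite size_nseq; exact: leqnn.
- by rewrite size_nseq; exact: leqnn.
- move=> S [iS _ opt]; rewrite set0E setU0 in iS; split=> // O iO.
  by have := opt O; rewrite set0E setU0 size_nseq => /(_ iO).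
Qed.

Lemma runs_exact : let k := mrank M in
  runs (run M exact_program vs es)
    (fun S => S \in indep M /\ forall O, O \in indep M -> 2 * cov es O <= 3 * cov es S)
    (51 * (size vs * size es * k ^ 3)) (5 * (size vs ^ 2 * (maxn 1 k) ^ 3)).
Proof.
move=> k; have set0E : mkset [::] = set0 by apply/setP=> z; rewrite !inE.
have wf := input_wf.
pose rho0 : env R V input_ctx := (es, (vs, tt)).
pose rho1 : env R V [:: LV & input_ctx] := ([::], rho0).
apply: run_runs.
apply: (@runs_let_ret R V M input_ctx LV LV _ _ rho0 [::]); first by [].
pose u := rev [seq y <- vs | has (incident y) es].
have uE y : (y \in u) = has (incident y) es by rewrite mem_rev mem_filter input_mem andbT.
apply: (@runs_let_ret R V M [:: LV & input_ctx] LV LV _ _ rho1 u).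
  exact: eval_active.
pose rho2 : env R V [:: LV, LV & input_ctx] := (u, rho1).
have uu : uniq u by rewrite rev_uniq filter_uniq // input_uniq.
have szu : (size u <= size vs)%N by rewrite size_rev size_filter count_size.
have ub : [disjoint mkset u & set0] by rewrite -setI_eq0 setI0.
pose N := contraction ub (indep0 M).
have NE : is_contraction M N u [::] by split=> // X; rewrite set0E inE.
have gr : runs (eval M (greedy_prog (V0 : var [:: LV, LV & input_ctx] LV) V1) rho2)
   (fun S => [/\ uniq (S : seq V), mkset S \in indep N &
       forall X, X \in indep N -> (#|X| <= size S)%N]) 0 (size u).
  apply: (@runs_greedy R V M [:: LV, LV & input_ctx] V0 V1 rho2 N NE).
  by rewrite /= set0E indep0.
eapply runs_le; first apply: (@runs_let R V M [:: LV, LV & input_ctx] LV LV _ _ rho2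
  _ _ _ _ (51 * (size vs * size es * k ^ 3))
  (4 * (size vs ^ 2 * (maxn 1 k) ^ 3)) gr).
- move=> S0 [uS0 iS0 maxS0].
  pose K := size (S0 : seq V).
  pose rho3 : env R V [:: LV, LV, LV & input_ctx] := (S0, rho2).
  have KP (X : {set V}) : (forall y, y \in X -> has (incident y) es) ->
      X \in indep M -> (#|X| <= K)%N.
    move=> Xact iX; apply: maxS0; rewrite (proj2 NE) set0E setU0 iX andbT.
    by apply/subsetP=> y /Xact; rewrite inE uE.
  have Kk : (K <= k)%N.
    rewrite /K -(card_uniqP uS0) -cardsE; apply: card_le_mrank.
    by move: iS0; rewrite (proj2 NE) set0E setU0 => /andP[].
  have [it itE szit] := @eval_square R V M [:: LV, LV, LV & input_ctx] V0 rho3.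
  apply: (@runs_let_ret R V M [:: LV, LV, LV & input_ctx] (TList TBool) LV
    _ _ rho3 it) => //.
  pose rho4 : env R V [:: TList TBool, LV, LV, LV & input_ctx] := (it, rho3).
  pose good (y : V) (a : seq V) := forall O, O \in indep M -> y \in O ->
    cov es O <= K%:R * cov es [set y] -> 2 * cov es O <= 3 * cov es (mkset a).
  pose I (l a : seq V) := mkset a \in indep M /\ forall y, y \in l -> good y a.
  eapply runs_weak; first apply: (@runs_for R V M [:: TList TBool, LV, LV, LV & input_ctx]
    TVertex LV _ _ _ rho4 u I
    (fun=> K * (size it * (23 * size es) + 5 * size es))%N
    (fun=> 1 + (size vs + size it * (K * size vs)))%N 0%N 0%N).
  + by [].
  + by apply: runs_nil; split=> //; rewrite set0E indep0.
  + move=> l1 y l2 a lE [ia opt].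
    have yact : has (incident y) es by rewrite -uE lE mem_cat mem_head orbT.
    pose rho5 : env R V [:: TVertex, LV, TList TBool, LV, LV, LV & input_ctx] :=
      (y, (a, rho4)).
    have szit' : (2 * K ^ 2 <= size it)%N by rewrite szit.
    have := @runs_guess R V M _ TBool V6 V7 V2 V0 V1 rho5 K wf input_uniq input_mem
      yact szit' ia KP.
    move=> H; apply: runs_weak H _ _ _; [exact: leqnn | exact: leqnn |].
    move=> S [iS le_aS good_y]; split=> // z.
    rewrite mem_rcons inE => /orP[/eqP->|zl]; first exact: good_y.
    move=> O iO zO oK; apply: le_trans (opt z zl O iO zO oK) _.
    by apply: ler_wpM2l.
  + rewrite add0n sum_nat_const_seq szit -[size (@lookup R V _ LV V0 rho3 : seq V)]/K.
    have K3 : (K <= K ^ 3)%N.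
      by case: (posnP K) => [->|K0] //; rewrite -{1}(expn1 K) leq_pexp2l.
    have kK : (K ^ 3 <= k ^ 3)%N by rewrite leq_exp2r.
    (* Two times 23 for the [2 * K ^ 2] rounds, plus 5 for comparing coverages. *)
    apply: (@leq_trans (size u * (51 * (size es * K ^ 3)))).
      rewrite leq_mul2l; apply/orP; right.
      have -> : (K * (2 * K ^ 2 * (23 * size es) + 5 * size es)
          = 46 * (size es * K ^ 3) + 5 * (size es * K))%N by rewrite !expnS expn0; lia.
      by have := leq_mul (leqnn (size es)) K3; lia.
    by rewrite mulnCA leq_mul2l -mulnA leq_mul // leq_mul2l kK orbT.
  + rewrite add0n sum_nat_const_seq szit -[size (@lookup R V _ LV V0 rho3 : seq V)]/K.
    have KM : (K ^ 3 <= maxn 1 k ^ 3)%N by rewrite leq_exp2r // (leq_trans Kk) ?leq_maxr.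
    have M0 : (0 < maxn 1 k ^ 3)%N by rewrite expn_gt0 leq_maxl.
    (* Per guess: one query for the singleton, n for the greedy set and [2 * K ^ 3 * n] for the
       rounds. The [maxn 1 k] keeps the first two bounded when the rank is 0. *)
    apply: (@leq_trans (size vs * (1 + (size vs + 2 * K ^ 2 * (K * size vs))))).
      by rewrite leq_mul2r szu orbT.
    move: (maxn 1 k ^ 3)%N KM M0 => m3 KM M0; set n := size vs.
    have -> : (4 * (n ^ 2 * m3) = n * (4 * (n * m3)))%N by rewrite !expnS expn0; lia.
    rewrite leq_mul2l; case: (posnP n) => //= n0.
    have -> : (2 * K ^ 2 * (K * n) = 2 * (K ^ 3 * n))%N by rewrite !expnS expn0; lia.
    by nia.
  + move=> S [iS good_u]; split=> // X iX.
    (* Dropping the isolated vertices keeps the coverage, ensures that the heavy vertex is among the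
       guesses, and bounds the size by [K]. *)
    pose O := X :&: mkset u.
    have <- : cov es O = cov es X.
      apply: cov_active => x xe; rewrite !inE !uE.
      by split; apply/hasP; exists x; rewrite // /incident eqxx ?orbT.
    have iO : O \in indep M by apply: indep_sub iX; exact: subsetIl.
    have [->|O0] := eqVneq O set0.
      by rewrite cov0 mulr0 mulr_ge0 // cov_ge0.
    have [y yO heavy] := heavy_vertex wf O0.
    have yu : y \in u by move: yO; rewrite !inE => /andP[].
    apply: (good_u y yu O iO yO); apply: le_trans heavy _.
    apply: ler_wpM2r; first exact: cov_ge0.
    rewrite ler_nat; apply: KP => // z; by rewrite !inE uE => /andP[].
- by rewrite add0n.
- have M0 : (0 < maxn 1 k ^ 3)%N by rewrite expn_gt0 leq_maxl.
  have : (size u <= size vs ^ 2 * maxn 1 k ^ 3)%N.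
    apply: leq_trans szu _; rewrite -mulnn -mulnA.
    case: (posnP (size vs)) => [->//|n0].
    by rewrite leq_pmulr // muln_gt0 n0.
  by lia.
Qed.

End Main.

Theorem theorem2 (R : realType) :
  (exists c0 c1 c2 : R, forall eps : R, 0 < eps ->
    exists P : program,
      forall (V : finType) (G : wgraph R V) (M : matroid V)
        (vs : seq V) (es : seq (V * V * R)), input_of G vs es ->
      let n := #|V| in let m := #|edges G| in let k := mrank M in
      let out := run M P vs es in
      [/\ result out \in indep M,
          coverage G (result out)
            >= (2 / 3 - c0 * (k%:R * eps)) * max_coverage G M,
          (ops out)%:R <= c1 * (m%:R * k%:R / eps) &
          (calls out)%:R <= c2 * (n%:R * (maxn 1 k)%:R / eps)])
  /\
  (exists c1 c2 : R, exists P : program,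
      forall (V : finType) (G : wgraph R V) (M : matroid V)
        (vs : seq V) (es : seq (V * V * R)), input_of G vs es ->
      let n := #|V| in let m := #|edges G| in let k := mrank M in
      let out := run M P vs es in
      [/\ result out \in indep M,
          coverage G (result out) >= 2 / 3 * max_coverage G M,
          (ops out)%:R <= c1 * (n%:R * m%:R * k%:R ^+ 3) &
          (calls out)%:R <= c2 * (n%:R ^+ 2 * (maxn 1 k)%:R ^+ 3)]).
Proof.
split; last first.
  exists 51, 5, exact_program => V G M vs es io n m k out.
  have [[iS opt] ho hc] := @runs_exact R V G M vs es io.
  rewrite (input_size_es io) (input_size_vs io) in ho hc.
  have wf := input_wf io.
  split=> //.
  - suff : max_coverage G M <= 3 / 2 * coverage G (result out) by lra.
    rewrite (input_cov io); apply: max_coverage_le => [|X iX].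
      by apply: mulr_ge0; [lra | exact: cov_ge0].
    by rewrite (input_cov io); have := opt X iX; rewrite -/out; lra.
  - by rewrite -natrX -!natrM ler_nat.
  - by rewrite -!natrX -!natrM ler_nat.
(* 46 is twice 23, as T is at most 2/eps; 3 adds to this 2 the n queries of the greedy set. *)
exists 1, 46, 3 => eps eps0.
have [eps1|eps1] := leP 1 eps.
  (* For large [eps] even one round may exceed the allowed costs. But then the promised factor is
     negative unless the rank is 0, where nothing can be covered; the empty set suffices. *)
  exists (ListNil _ _) => V G M vs es io n m k out.
  have outE : result out = set0 by apply/setP=> x; rewrite !inE.
  have wf := input_wf io.
  have mc0 : 0 <= max_coverage G M by apply: bigmax_ge_id.
  split.
  - by rewrite outE indep0.
  - rewrite outE (input_cov io) cov0.
    have [k0|k0] := posnP k.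
      suff -> : max_coverage G M = 0 by rewrite mulr0.
      apply/le_anti; rewrite mc0 andbT; apply: max_coverage_le => // X iX.
      have := card_le_mrank iX; rewrite -/k k0 leqn0 cards_eq0 => /eqP->.
      by rewrite (input_cov io) cov0.
    have k1 : 1 <= k%:R :> R by rewrite ler1n.
    have : 1 <= k%:R * eps by have := ler_pM ler01 ler01 k1 eps1; rewrite mulr1.
    by nra.
  - have -> : ops out = 0%N by [].
    by apply: mulr_ge0 => //; apply: divr_ge0; [exact: mulr_ge0 | exact: ltW].
  - have -> : calls out = 0%N by [].
    by apply: mulr_ge0 => //; apply: divr_ge0; [exact: mulr_ge0 | exact: ltW].
(* The successor makes T exceed 1/eps, which the approximation needs; [eps < 1] keeps it below
   2/eps, which the costs need. *)
pose T := (Num.truncn eps^-1).+1.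
have epsV0 : 0 < eps^-1 by rewrite invr_gt0.
have TP : eps^-1 < T%:R by exact: truncnS_gt.
have T2 : T%:R <= 2 * eps^-1.
  have : (Num.truncn eps^-1)%:R <= eps^-1 by rewrite truncn_le ltW.
  have : 1 < eps^-1 by rewrite invf_gt1.
  by rewrite /T -natr1; lra.
have T0 : 0 < T%:R :> R by rewrite ltr0n.
exists (approx_program T) => V G M vs es io n m k out.
have [[iS opt] ho hc] := @runs_approx R V G M vs es io T.
rewrite (input_size_es io) (input_size_vs io) -/n -/m -/k -/out in ho hc opt iS.
have wf := input_wf io.
have F0 : 0 <= cov es (result out) by apply: cov_ge0.
split=> //.
- rewrite (input_cov io) mul1r.
  have kT : 0 < (T + k)%:R :> R by rewrite natrD ltr_pwDl.
  have k0 : 0 <= k%:R :> R := ler0n _ _.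
  have mc0 : 0 <= max_coverage G M by apply: bigmax_ge_id.
  have mc : 2 * T%:R * max_coverage G M <= 3 * (T + k)%:R * cov es (result out).
    rewrite -ler_pdivlMl ?mulr_gt0 //; apply: max_coverage_le => [|X iX].
      apply: mulr_ge0; first by rewrite invr_ge0; exact: mulr_ge0.
      by apply: mulr_ge0 => //; exact: mulr_ge0.
    by rewrite (input_cov io) ler_pdivlMl ?mulr_gt0 // opt.
  have c0 : 0 < 3 * (T + k)%:R :> R by rewrite mulr_gt0.
  (* What remains is 3(T + k)(2/3 - k eps) <= 2T. The excess 2k is absorbed by 3Tk eps, since T eps
     is at least 1. *)
  rewrite -(ler_pM2l c0); apply: le_trans mc; rewrite mulrA; apply: ler_wpM2r => //.
  have Te : 1 <= T%:R * eps by rewrite -ler_pdivrMr // mul1r ltW.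
  have : 0 <= k%:R * k%:R * eps by rewrite mulr_ge0 ?mulr_ge0 // ltW.
  have : 0 <= k%:R * (T%:R * eps - 1) by rewrite mulr_ge0 // subr_ge0.
  by rewrite natrD; nra.
- have : (ops out)%:R <= T%:R * (23 * (m%:R * k%:R)) :> R by rewrite -!natrM ler_nat.
  move=> h; apply: le_trans h _.
  have : 0 <= m%:R * k%:R :> R by rewrite mulr_ge0.
  by nra.
- have : (calls out)%:R <= (n + T * (k * n))%:R :> R by rewrite ler_nat.
  move=> h; apply: le_trans h _.
  have kM : k%:R <= (maxn 1 k)%:R :> R by rewrite ler_nat leq_maxr.
  have M1 : 1 <= (maxn 1 k)%:R :> R by rewrite ler1n leq_maxl.
  have n0 : 0 <= n%:R :> R := ler0n _ _.
  have e1 : 1 <= eps^-1 by rewrite invf_ge1 // ltW.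
  have h1 : n%:R * 1 <= n%:R * ((maxn 1 k)%:R / eps).
    by apply: ler_wpM2l => //; have := ler_pM ler01 ler01 M1 e1; rewrite mulr1.
  have h2 : T%:R * k%:R <= 2 / eps * (maxn 1 k)%:R by apply: ler_pM.
  have h3 := ler_wpM2r n0 h2.
  by rewrite natrD !natrM; lra.
Qed.
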